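(* Let $N$ be a well-formed labeled portnet whose net system $(N,\textit{init}_N,\textit{fin}_N)$ is weakly terminating, and let $(M_1,\phi_1),\dots,(M_n,\phi_n)$, $n\in\mathbb{N}$, be partial mirrors of $N$ with pairwise disjoint skeletons. Let $(\mathcal{C},S,\{q,q_1,\dots,q_n\})$ be the synchronization pattern with $n$ clients, with skeletons disjoint from those of $N,M_1,\dots,M_n$. Let $\mathcal{C}'=\{C_1\odot_{q_1}M_1,\dots,C_n\odot_{q_n}M_n\}$, $S'=S\odot_q N$ and $L=\textit{compose}(\mathcal{C}'\cup\{S'\})$, with initial marking $m_0=i+i_1+\dots+i_n$ and final marking $m_f=i+r_1+\dots+r_n$. Then the net system $(L,m_0,m_f)$ is weakly terminating.
   Context: Petri nets. Labeled Petri net $(P,T,F,\mathcal{L},\mu)$, ${}^\bullet x=\{y\mid (y,x)\in F\}$, $x^\bullet=\{y\mid (x,y)\in F\}$; markings $m:P\to\mathbb{N}$; $t$ enabled iff ${}^\bullet t\le m$, firing gives $m-{}^\bullet t+t^\bullet$; a net system $(N,m_0,m_f)$ is weakly terminating if $m_f$ is reachable from every marking reachable from $m_0$. A path is a sequence of nodes with consecutive pairs in $F$. OPNs. $N=(P,I,O,T,F,\textit{init},\textit{fin},\mathcal{L},\mu)$ with $P,I,O$ pairwise disjoint, $(P\cup I\cup O,T,F,\mathcal{L},\mu)$ a labeled Petri net, ${}^\bullet x=\emptyset$ for $x\in I$, $x^\bullet=\emptyset$ for $x\in O$, each $t$ has ${}^\bullet t\cap I=\emptyset$ or $t^\bullet\cap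 O=\emptyset$, $\textit{init},\textit{fin}\subseteq P$. $\lambda(t)=\textit{send}$ if $t^\bullet\cap O\neq\emptyset$, $\textit{receive}$ if ${}^\bullet t\cap I\ne\emptyset$, else $\tau$. Skeleton: net on $P,T$ with arcs $F\cap((P\times T)\cup(T\times P))$. The net system of an OPN has initial marking $\textit{init}$ and final marking $\textit{fin}$. Labeled portnet: OPN whose skeleton has every transition with at most one input and one output place and is a workflow net (unique place $i$ with empty preset, unique place $f$ with empty postset, all nodes on a path from $i$ to $f$) with $\textit{init}=\{i\}$, $\textit{fin}=\{f\}$; every transition connected to exactly one interface place; transitions sharing an interface place share a label; transitions with equal labels are connected to the same interface place(s). Composition: OPNs $N,M$ are composable iff shared nodes are exactly $(I_N\cup O_N)\cap(I_M\cup O_M)$ and, if $(I_N\cap O_M)\cup(I_M\cap O_N)\ne\emptyset$, then $O_N\subseteq I_M$, $O_M\subseteq I_N$, $I_N\cap I_M=O_N\cap O_M=\emptyset$. $\textit{compose}$ of pairwise composable OPNs: places $\bigcup P\cup(\bigcup I\cap\bigcup O)$, inputs $\bigcup I\setminus\bigcup O$, outputs $\bigcup O\setminus\bigcup I$, other components unions. Partial mirror of $N$: $(M,\phi)$, $M$ a labeled portnet, $\phi$ injective from nodes of $M$ to nodes of $N$ with $\phi(P_M)\subseteq P_N$, $\phi(T_M)\subseteq T_N$, $\phi(I_M)\subseteq O_N$, $\phi(O_M)\subseteq I_N$; for $(x,y)\in F_M$: if $x\notin I_M,y\notin O_M$ then $(\phi(x),\phi(y))\in F_N$, if $x\in I_M$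 or $y\in O_M$ then $(\phi(y),\phi(x))\in F_N$; $\phi(\textit{init}_M)=\textit{init}_N$, $\phi(\textit{fin}_M)=\textit{fin}_N$; $\mu_M(t)=\mu_N(\phi(t))$; for all $p\in P_M$, $t\in\phi(p)^\bullet$ with $\lambda(t)=\textit{send}$ there is $t'\in p^\bullet$ with $\phi(t')=t$. In compositions, each interface place $x$ of $M_j$ is the same place as $\phi_j(x)$ of $N$. Well-formed labeled portnet: observable choices (distinct $t,t'\in p^\bullet$ have distinct labels); diamond property (for $p\in P$, $t,t'\in p^\bullet$ with $\lambda(t)\neq\lambda(t')$, for all $q\in t^\bullet\cap P$, $q'\in t'^\bullet\cap P$ there are $u\in q^\bullet$, $u'\in q'^\bullet$ with $u^\bullet\cap u'^\bullet\ne\emptyset$, $\mu(t)=\mu(u')$, $\mu(t')=\mu(u)$); loop property (for $p\in P$ and distinct $t,t'\in p^\bullet$ with $\lambda(t)=\lambda(t')$, every path $\langle p\rangle\circ\pi$ whose transitions are $\langle t\rangle\circ\sigma\circ\langle t''\rangle$ with $\mu(t'')=\mu(t')$ and no transition of $\sigma$ labeled $\mu(t')$ contains a transition with direction $\neq\lambda(t)$). Place refinement: for disjoint labeled OPNs $N,M$ and $p\in P_N$, $N\odot_p M$ has places $(P_N\setminus\{p\})\cup P_M$, inputs $I_N\cup I_M$, outputs $O_N\cup O_M$, transitions $T_N\cup T_M$, arcs $(F_N\setminus(({}^\bullet p\times\{p\})\cup(\{p\}\times p^\bullet)))\cup F_M\cup({}^\bullet p\times\textit{init}_M)\cup(\textit{fin}_M\times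 p^\bullet)$, $\textit{init}=\textit{init}_N$, $\textit{fin}=\textit{fin}_N$, labeling $\mu_N\cup\mu_M$. Synchronization pattern with $n$ clients: server OPN $S$ with internal places $i,p,q,r$, input places $a_1,a_3$, output place $a_2$, transitions $u,v,w,t$ with ${}^\bullet u=\{i,a_1\}$, $u^\bullet=\{p\}$; ${}^\bullet v=\{p\}$, $v^\bullet=\{q,a_2\}$; ${}^\bullet w=\{q,a_3\}$, $w^\bullet=\{r\}$; ${}^\bullet t=\{r\}$, $t^\bullet=\{i\}$; $\textit{init}_S=\{i\}$. Client OPNs $C_j$ ($1\le j\le n$) with internal places $i_j,p_j,q_j,r_j$, input place $a_2$, output places $a_1,a_3$, transitions $u_j,v_j,w_j$ with ${}^\bullet u_j=\{i_j\}$, $u_j^\bullet=\{p_j,a_1\}$; ${}^\bullet v_j=\{p_j,a_2\}$, $v_j^\bullet=\{q_j\}$; ${}^\bullet w_j=\{q_j\}$, $w_j^\bullet=\{r_j,a_3\}$; $\textit{init}=\{i_j\}$, $\textit{fin}=\{r_j\}$; $\mu(u_j)=\mu(u)$, $\mu(v_j)=\mu(v)$, $\mu(w_j)=\mu(w)$. $\mathcal{C}=\{C_1,\dots,C_n\}$; refinable places $q,q_1,\dots,q_n$; clients share the places $a_1,a_2,a_3$ with $S$ and with each other. *)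

(* Defs.v *)
From mathcomp Require Import all_boot.
From mathcomp Require Import boolp classical_sets.
From Stdlib Require Import Relation_Operators.
Set Implicit Arguments.
Unset Strict Implicit.
Unset Printing Implicit Defensive.
Local Open Scope classical_set_scope.

(** All nets draw their nodes (places and transitions) from one universe [U],
    so that nets sharing a node are glued along it. *)

Section Nets.
Variables (U : eqType) (Lb : Type).

(** [net_lab] is the graph of the labeling, which makes unions of labelings
    literal unions. *)
Record net := Net {
  net_pl : set U;
  net_tr : set U;
  net_flow : set (U * U);
  net_labels : set Lb;
  net_lab : set (U * Lb) }.

Definition is_net (N : net) : Prop :=
  [/\ net_pl N `&` net_tr N = set0,
      net_flow N `<=` (net_pl N `*` net_tr N) `|` (net_tr N `*` net_pl N),
      net_lab N `<=` net_tr N `*` net_labels N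
    & forall t, net_tr N t -> exists! l, net_lab N (t, l)].

Definition net_nodes (N : net) : set U := net_pl N `|` net_tr N.

Definition preset (F : set (U * U)) (x : U) : set U := [set y | F (y, x)].
Definition postset (F : set (U * U)) (x : U) : set U := [set y | F (x, y)].

(** A marking of a net is a function on [U] that vanishes off the places;
    firing preserves this. *)
Definition marking := U -> nat.
Definition bag (A : set U) : marking := fun x => (x \in A : nat).

Definition enabled (N : net) (m : marking) (t : U) : Prop :=
  net_tr N t /\ forall x, bag (preset (net_flow N) t) x <= m x.

Definition fire (N : net) (m : marking) (t : U) : marking :=
  fun x => m x - bag (preset (net_flow N) t) x + bag (postset (net_flow N) t) x.

Definition step (N : net) (m m' : marking) : Prop :=
  exists2 t, enabled N m t & m' = fire N m t.

Definition reachable (N : net) : marking -> marking -> Prop :=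
  clos_refl_trans marking (step N).

Definition weakly_terminating (N : net) (m0 mf : marking) : Prop :=
  forall m, reachable N m0 m -> reachable N m mf.

(** [x :: s] is a path. *)
Definition is_path (F : set (U * U)) (x : U) (s : seq U) : bool :=
  path (fun y z => (y, z) \in F) x s.

Definition workflow_net (N : net) (i f : U) : Prop :=
  [/\ [set x | net_pl N x /\ preset (net_flow N) x = set0] = [set i],
      [set x | net_pl N x /\ postset (net_flow N) x = set0] = [set f]
    & forall x, net_nodes N x ->
        exists s, [/\ is_path (net_flow N) i s, last i s = f & x \in i :: s]].

Record opn := Opn {
  pl : set U;
  inp : set U;
  outp : set U;
  tr : set U;
  flow : set (U * U);
  ini : set U;
  fin : set U;
  labels : set Lb;
  lab : set (U * Lb) }.

Definition iface (N : opn) : set U := inp N `|` outp N.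

(** The net with its interface places, as opposed to [skeleton]. *)
Definition net_of (N : opn) : net :=
  Net (pl N `|` inp N `|` outp N) (tr N) (flow N) (labels N) (lab N).

Definition skeleton (N : opn) : net :=
  Net (pl N) (tr N)
      (flow N `&` ((pl N `*` tr N) `|` (tr N `*` pl N))) (labels N) (lab N).

Definition nodes (N : opn) : set U := net_nodes (net_of N).

Definition is_opn (N : opn) : Prop :=
  [/\ [/\ pl N `&` inp N = set0, pl N `&` outp N = set0
        & inp N `&` outp N = set0],
      is_net (net_of N),
      (forall x, inp N x -> preset (flow N) x = set0)
        /\ (forall x, outp N x -> postset (flow N) x = set0),
      (forall t, tr N t -> preset (flow N) t `&` inp N = set0
                        \/ postset (flow N) t `&` outp N = set0)
    & ini N `<=` pl N /\ fin N `<=` pl N].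

Inductive direction := Send | Receive | Silent.

Definition dir (N : opn) (t : U) : direction :=
  if `[< postset (flow N) t `&` outp N !=set0 >] then Send
  else if `[< preset (flow N) t `&` inp N !=set0 >] then Receive
  else Silent.

(** The label of [t] in [N] equals the label of [t'] in [M]. *)
Definition same_label (N : opn) (t : U) (M : opn) (t' : U) : Prop :=
  exists l, lab N (t, l) /\ lab M (t', l).

Definition iface_of (N : opn) (t : U) : set U :=
  [set x | iface N x /\ (flow N (x, t) \/ flow N (t, x))].

Definition labeled_portnet (N : opn) : Prop :=
  [/\ is_opn N,
      (forall t, tr N t -> is_subset1 (preset (net_flow (skeleton N)) t)
                        /\ is_subset1 (postset (net_flow (skeleton N)) t)),
      (exists i f, [/\ workflow_net (skeleton N) i f,
                       ini N = [set i] & fin N = [set f]]),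
      (forall t, tr N t -> exists x, iface_of N t = [set x])
    & forall t t', tr N t -> tr N t' ->
        (iface_of N t `&` iface_of N t' !=set0 -> same_label N t N t')
        /\ (same_label N t N t' -> iface_of N t = iface_of N t')].

Definition observable_choices (N : opn) : Prop :=
  forall p t t', pl N p -> postset (flow N) p t -> postset (flow N) p t' ->
    t <> t' -> ~ same_label N t N t'.

Definition diamond_property (N : opn) : Prop :=
  forall p t t', pl N p -> postset (flow N) p t -> postset (flow N) p t' ->
    dir N t <> dir N t' ->
    forall q q', (postset (flow N) t `&` pl N) q ->
      (postset (flow N) t' `&` pl N) q' ->
    exists u u', [/\ postset (flow N) q u, postset (flow N) q' u',
      postset (flow N) u `&` postset (flow N) u' !=set0,
      same_label N t N u' & same_label N t' N u].

Definition loop_property (N : opn) : Prop :=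
  forall p t t', pl N p -> postset (flow N) p t -> postset (flow N) p t' ->
    t <> t' -> dir N t = dir N t' ->
    forall (s sigma : seq U) (t'' : U), is_path (flow N) p s ->
      [seq x <- s | x \in tr N] = t :: rcons sigma t'' ->
      same_label N t'' N t' ->
      (forall x, x \in sigma -> ~ same_label N x N t') ->
    exists x, [/\ x \in s, tr N x & dir N x <> dir N t].

Definition well_formed (N : opn) : Prop :=
  [/\ labeled_portnet N, observable_choices N, diamond_property N
    & loop_property N].

Definition partial_mirror (N M : opn) (phi : U -> U) : Prop :=
  [/\ labeled_portnet M,
      {in nodes M &, injective phi},
      [/\ phi @` pl M `<=` pl N, phi @` tr M `<=` tr N,
          phi @` inp M `<=` outp N & phi @` outp M `<=` inp N],
      (forall x y, flow M (x, y) ->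
         (~ inp M x /\ ~ outp M y -> flow N (phi x, phi y))
         /\ (inp M x \/ outp M y -> flow N (phi y, phi x)))
    & [/\ phi @` ini M = ini N, phi @` fin M = fin N,
          forall t, tr M t -> same_label M t N (phi t)
        & forall p t, pl M p -> postset (flow N) (phi p) t -> dir N t = Send ->
            exists2 t', postset (flow M) p t' & phi t' = t]].

(** [compose] is the total operation given by the formulas that define the
    composition of pairwise composable nets; [share_only_interface] is the part
    of composability that concerns node sharing. *)

Definition share_only_interface (N M : opn) : Prop :=
  nodes N `&` nodes M = iface N `&` iface M.

Definition composable (N M : opn) : Prop :=
  share_only_interface N M /\
  ((inp N `&` outp M) `|` (inp M `&` outp N) !=set0 ->
   [/\ outp N `<=` inp M, outp M `<=` inp N,
       inp N `&` inp M = set0 & outp N `&` outp M = set0]).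

Definition compose (A : set opn) : opn :=
  let In := \bigcup_(N in A) inp N in
  let Out := \bigcup_(N in A) outp N in
  Opn (\bigcup_(N in A) pl N `|` (In `&` Out)) (In `\` Out) (Out `\` In)
      (\bigcup_(N in A) tr N) (\bigcup_(N in A) flow N)
      (\bigcup_(N in A) ini N) (\bigcup_(N in A) fin N)
      (\bigcup_(N in A) labels N) (\bigcup_(N in A) lab N).

(** Refinement of the place [p] of [N] by [M]; meaningful when
    [disjoint_nodes N M]. *)

Definition disjoint_nodes (N M : opn) : Prop := nodes N `&` nodes M = set0.

Definition disjoint_skeletons (N M : opn) : Prop :=
  net_nodes (skeleton N) `&` net_nodes (skeleton M) = set0.

Definition refine (N : opn) (p : U) (M : opn) : opn :=
  Opn ((pl N `\ p) `|` pl M) (inp N `|` inp M) (outp N `|` outp M)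
      (tr N `|` tr M)
      ((flow N `\` ((preset (flow N) p `*` [set p])
                    `|` ([set p] `*` postset (flow N) p)))
       `|` flow M
       `|` (preset (flow N) p `*` ini M)
       `|` (fin M `*` postset (flow N) p))
      (ini N) (fin N) (labels N `|` labels M) (lab N `|` lab M).

End Nets.

(** Synchronization pattern.  [sync_node n] lists its nodes: the shared
    interface places, the server's nodes and, for each client, its nodes;
    the pattern is realized in [U] by an injection of this type. *)

Inductive sync_node (n : nat) :=
| A1 | A2 | A3
| Si | Sp | Sq | Sr | Su | Sv | Sw | St
| Ci of 'I_n | Cp of 'I_n | Cq of 'I_n | Cr of 'I_n
| Cu of 'I_n | Cv of 'I_n | Cw of 'I_n.
Arguments A1 {n}. Arguments A2 {n}. Arguments A3 {n}.
Arguments Si {n}. Arguments Sp {n}. Arguments Sq {n}. Arguments Sr {n}.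
Arguments Su {n}. Arguments Sv {n}. Arguments Sw {n}. Arguments St {n}.

Section Sync.
Variables (U : eqType) (Lb : Type) (n : nat) (e : sync_node n -> U).
Variables (lu lv lw lt : Lb).

(** The server's final place is taken to be [i], in accordance with the final
    marking of the composed system. *)
Definition sync_server : opn U Lb :=
  Opn [set e Si; e Sp; e Sq; e Sr] [set e A1; e A3] [set e A2]
      [set e Su; e Sv; e Sw; e St]
      [set (e Si, e Su); (e A1, e Su); (e Su, e Sp);
           (e Sp, e Sv); (e Sv, e Sq); (e Sv, e A2);
           (e Sq, e Sw); (e A3, e Sw); (e Sw, e Sr);
           (e Sr, e St); (e St, e Si)]
      [set e Si] [set e Si]
      [set lu; lv; lw; lt]
      [set (e Su, lu); (e Sv, lv); (e Sw, lw); (e St, lt)].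

Definition sync_client (j : 'I_n) : opn U Lb :=
  Opn [set e (Ci j); e (Cp j); e (Cq j); e (Cr j)] [set e A2] [set e A1; e A3]
      [set e (Cu j); e (Cv j); e (Cw j)]
      [set (e (Ci j), e (Cu j)); (e (Cu j), e (Cp j)); (e (Cu j), e A1);
           (e (Cp j), e (Cv j)); (e A2, e (Cv j)); (e (Cv j), e (Cq j));
           (e (Cq j), e (Cw j)); (e (Cw j), e (Cr j)); (e (Cw j), e A3)]
      [set e (Ci j)] [set e (Cr j)]
      [set lu; lv; lw]
      [set (e (Cu j), lu); (e (Cv j), lv); (e (Cw j), lw)].

Definition sync_m0 : marking U :=
  fun x => bag [set e Si] x + \sum_(j < n) bag [set e (Ci j)] x.

Definition sync_mf : marking U :=
  fun x => bag [set e Si] x + \sum_(j < n) bag [set e (Cr j)] x.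

Variables (N : opn U Lb) (M : 'I_n -> opn U Lb).

Definition refined_server : opn U Lb := refine sync_server (e Sq) N.

Definition refined_client (j : 'I_n) : opn U Lb :=
  refine (sync_client j) (e (Cq j)) (M j).

Definition refined_family : set (opn U Lb) :=
  [set refined_client j | j in [set: 'I_n]] `|` [set refined_server].

End Sync.

(* Main.v *)
(** A portnet is a state machine [N] all of whose steps send or receive one
    message, determined by the label. While a client [j] talks to the server,
    with [N] at [x] and the mirror at [y], the messages in transit are exactly
    those of a run of sends of [N] from [phi j y] and of a run of receives of
    [N] from [x] having a common endpoint. The diamond property preserves this
    when a message is sent. By the loop property, a pending message that can be
    received is the first one of its run, so receiving preserves it too. Hence
    the channels can always be emptied, with [N] in the state of the mirror;
    then both follow a path of the mirror to its final place. The handshake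
    through [a1], [a2], [a3] lets at most one client talk at a time, and each
    round moves one more client to its final place. *)

Require Import Defs.
From mathcomp Require Import all_boot.
From mathcomp Require Import boolp classical_sets.
From mathcomp Require Import zify.
From Stdlib Require Import Relation_Operators.
Set Implicit Arguments.
Unset Strict Implicit.
Unset Printing Implicit Defensive.
Local Open Scope classical_set_scope.

(** Interface places are unordered, so the messages in transit form a bag, and the two runs of the
    invariant only order it up to permutation. The beginning and the end of a conversation are
    degenerate cases. Before the client takes [a2], only [N] has acted, from [iN], the image of the
    mirror's initial place. Once the mirror is at its final place, no move leaves the image [fN]:
    nothing sent by [N] is pending, and by the diamond property [N] can no longer send. The argument
    is carried out on abstract configurations. The disjointness hypotheses make their nodes distinct
    in the universe of nodes, so that the firings of the composed net at a coherent configuration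
    are exactly the abstract steps. *)

Lemma disj_in T (A B : set T) x : A `&` B = set0 -> A x -> B x -> False.
Proof. by move=> E Ax Bx; have : (A `&` B) x by []; rewrite E. Qed.

(** * Portnets *)

Section Portnets.
Variables (U : eqType) (Lb : Type).
Implicit Types N M : opn U Lb.

(** Both arc fields are equivalences, so they fix the whole preset and postset, as enabledness
    requires. *)
Record arcs_of N t (d : bool) p a q : Prop := ArcsOf {
  arcs_tr : tr N t;
  arcs_src : pl N p;
  arcs_dst : pl N q;
  arcs_iface : if d then outp N a else inp N a;
  arcs_in : forall x, flow N (x, t) <-> x = p \/ ~~ d /\ x = a;
  arcs_out : forall x, flow N (t, x) <-> x = q \/ d /\ x = a }.

(** The edge from [p] to [q] of the state machine [N] communicating through
    the interface place [a]: sending if [d], receiving otherwise. *)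
Definition move N d p a q := exists t, arcs_of N t d p a q.

Section Opn.
Variable N : opn U Lb.
Hypothesis N_opn : is_opn N.

Lemma pl_inp x : pl N x -> inp N x -> False.
Proof. by case: N_opn => -[+ _ _] _ _ _ _; apply: disj_in. Qed.

Lemma pl_outp x : pl N x -> outp N x -> False.
Proof. by case: N_opn => -[_ + _] _ _ _ _; apply: disj_in. Qed.

Lemma inp_outp x : inp N x -> outp N x -> False.
Proof. by case: N_opn => -[_ _ +] _ _ _ _; apply: disj_in. Qed.

Lemma place_tr x : pl N x \/ iface N x -> tr N x -> False.
Proof.
case: N_opn => _ [plt _ _ _] _ _ _ xN; apply: (disj_in plt).
by case: xN => [|[]] xN; [left; left|left; right|right].
Qed.

Lemma pl_iface x : pl N x -> iface N x -> False.
Proof. by move=> px [/(pl_inp px)|/(pl_outp px)]. Qed.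

Lemma flow_nodes x y : flow N (x, y) ->
  (pl N x \/ iface N x) /\ tr N y \/ tr N x /\ (pl N y \/ iface N y).
Proof.
case: N_opn => _ [_ + _ _] _ _ _ => /[apply] -[] [] /=; rewrite /iface/setU/=;
by tauto.
Qed.

Lemma inp_no_pre x y : inp N y -> flow N (x, y) -> False.
Proof.
case: N_opn => _ _ [+ _] _ _ => /[apply] + xy.
by move=> /seteqP[/(_ x xy)].
Qed.

Lemma outp_no_post x y : outp N x -> flow N (x, y) -> False.
Proof.
case: N_opn => _ _ [_ +] _ _ => /[apply] + xy.
by move=> /seteqP[/(_ y xy)].
Qed.

Lemma ini_pl i : ini N = [set i] -> pl N i.
Proof. by case: N_opn => _ _ _ _ [h _] iE; apply: h; rewrite iE. Qed.

Lemma fin_pl f : fin N = [set f] -> pl N f.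
Proof. by case: N_opn => _ _ _ _ [_ h] fE; apply: h; rewrite fE. Qed.

End Opn.

Lemma skel_flow N x y : net_flow (skeleton N) (x, y) <->
  flow N (x, y) /\ (pl N x /\ tr N y \/ tr N x /\ pl N y).
Proof. by []. Qed.

Lemma path_prev (F : set (U * U)) x s y : is_path F x s -> y \in s ->
  exists z, F (z, y).
Proof.
move=> xs /splitPr E; case: E xs => s1 s2; rewrite /is_path cat_path /=.
by case/and3P=> _ /set_mem yF _; exists (last x s1).
Qed.

Lemma path_next (F : set (U * U)) x s y : is_path F x s -> y \in x :: s ->
  y = last x s \/ exists z, F (y, z).
Proof.
move=> xs /splitPl E; case: E xs => s1 s2 lE; rewrite /is_path cat_path /= lE.
case: s2 => [|z s2] /=; rewrite last_cat lE; first by left.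
by case/and3P=> _ /set_mem yF _; right; exists z.
Qed.

(** * Transitions of a portnet as moves *)

Section Portnet.
Variable N : opn U Lb.
Hypothesis N_port : labeled_portnet N.

Let N_opn : is_opn N. Proof. by case: N_port. Qed.

(** A workflow path through [t] starts and ends at places, hence gives [t] a neighbour on each side.
    The bound on the skeleton makes them unique, and the single interface place decides the
    direction. *)
Lemma tr_arcs t : tr N t -> exists d p a q, arcs_of N t d p a q.
Proof.
move=> tt; case: N_port => _ /(_ t tt)[pre1 post1] [i [f [[iP fP onp] _ _]]]
  /(_ t tt)[a aE] _.
have nodet : net_nodes (skeleton N) t by right.
have [s [pth lst ts]] := onp t nodet.
have pli : pl N i by have := erefl : [set i] i; rewrite -iP => -[].
have plf : pl N f by have := erefl : [set f] f; rewrite -fP => -[].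
have nplt : ~ pl N t by move=> pt; apply: (place_tr N_opn _ tt); left.
have [p pt] : exists p, net_flow (skeleton N) (p, t).
  apply: path_prev pth _; move: ts; rewrite inE => /orP[/eqP te|//].
  by rewrite te in nplt.
have [q tq] : exists q, net_flow (skeleton N) (t, q).
  by case: (path_next pth ts) => // te; rewrite te lst in nplt.
have [pt' plp] : flow N (p, t) /\ pl N p.
  by case/skel_flow: pt => ? [[]|[]].
have [tq' plq] : flow N (t, q) /\ pl N q.
  by case/skel_flow: tq => ? [[]|[]].
have [ai af] : iface_of N t a by rewrite aE.
have inE x : flow N (x, t) -> x = p \/ inp N x /\ x = a.
  move=> xt; case: (flow_nodes N_opn xt) => [[[px|[ix|ox]] _]|[_ []]] //.
  - by left; apply: (pre1 x p) => //; apply/skel_flow; split => //; left.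
  - right; split => //; have : iface_of N t x by split; left.
    by rewrite aE.
  - by case: (outp_no_post N_opn ox xt).
  - by move=> it; case: (place_tr N_opn (or_intror it) tt).
have outE x : flow N (t, x) -> x = q \/ outp N x /\ x = a.
  move=> xt; case: (flow_nodes N_opn xt) => [[[]]|[_ [px|[ix|ox]]]] //.
  - by move=> it; case: (place_tr N_opn (or_intror it) tt).
  - by left; apply: (post1 x q) => //; apply/skel_flow; split => //; right.
  - by case: (inp_no_pre N_opn ix xt).
  - right; split => //; have : iface_of N t x by split; right.
    by rewrite aE.
case: ai => [ia|oa].
  have at_ : flow N (a, t).
    by case: af => // /(inp_no_pre N_opn ia).
  exists false, p, a, q; split=> //= x; split.
  - by move/inE => [|[_]]; [left|right].
  - by case=> [->|[_ ->]].
  - by move/outE => [|[/[swap] -> /(inp_outp N_opn ia)]]; [left|].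
  - by case=> [->|[]].
have ta_ : flow N (t, a).
  by case: af => // /(outp_no_post N_opn oa).
exists true, p, a, q; split=> //= x; split.
- by move/inE => [|[/[swap] -> /(inp_outp N_opn) /(_ oa)]]; [left|].
- by case=> [->|[]].
- by move/outE => [|[_]]; [left|right].
- by case=> [->|[_ ->]].
Qed.

Lemma arcs_iface_of t d p a q : arcs_of N t d p a q -> iface_of N t = [set a].
Proof.
move=> [tt _ _ ai ain aout]; case: N_port => _ _ _ /(_ t tt)[b bE] _.
suff : iface_of N t a by rewrite bE => ->.
split; first by case: {+}d ai; [right|left].
case: d {ai} ain aout => ain aout; [right; apply/aout|left; apply/ain];
by right.
Qed.

Lemma arcs_inj t d p a q d' p' a' q' :
  arcs_of N t d p a q -> arcs_of N t d' p' a' q' ->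
  [/\ d = d', p = p', a = a' & q = q'].
Proof.
move=> A A'; have aE : a = a'.
  have : [set a'] a by rewrite -(arcs_iface_of A') (arcs_iface_of A).
  by [].
have ia : iface N a.
  by have := arcs_iface A; case: (d); [right|left].
subst a'; split => //.
- have := arcs_iface A; have := arcs_iface A'.
  by case: d d' {A A'} => -[] // h1 h2; case: (@inp_outp N N_opn a).
- have /(arcs_in A') [//|[_ E]] : flow N (p, t) by apply/(arcs_in A); left.
  by case: (pl_iface N_opn (arcs_src A)); rewrite E.
- have /(arcs_out A') [//|[_ E]] : flow N (t, q) by apply/(arcs_out A); left.
  by case: (pl_iface N_opn (arcs_dst A)); rewrite E.
Qed.

Lemma post_move p t : pl N p -> flow N (p, t) ->
  exists d a q, arcs_of N t d p a q.
Proof.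
move=> plp pt; have tt : tr N t.
  case: (flow_nodes N_opn pt) => -[] // tp _.
  by case: (place_tr N_opn (or_introl plp) tp).
have [d [p' [a [q A]]]] := tr_arcs tt; exists d, a, q.
have [->//|[d0 pE]] := (arcs_in A _).1 pt.
case: (pl_iface N_opn plp); rewrite pE; left.
by have := arcs_iface A; case: (d) d0.
Qed.

(** With the next lemma, equal labels amount to equal interface places, so that messages can be
    named by places. *)
Lemma arcs_same_label t d p a q t' d' p' q' :
  arcs_of N t d p a q -> arcs_of N t' d' p' a q' -> same_label N t N t'.
Proof.
move=> A A'; case: N_port => _ _ _ _ /(_ t t' (arcs_tr A) (arcs_tr A'))[+ _].
by apply; exists a; rewrite (arcs_iface_of A) (arcs_iface_of A').
Qed.

Lemma same_label_arcs t d p a q t' d' p' a' q' :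
  arcs_of N t d p a q -> arcs_of N t' d' p' a' q' -> same_label N t N t' ->
  a' = a /\ d' = d.
Proof.
move=> A A'.
case: N_port => _ _ _ _ /(_ t t' (arcs_tr A) (arcs_tr A'))[_ /[apply]].
rewrite (arcs_iface_of A) (arcs_iface_of A') => E.
have aE : [set a] a' by rewrite E.
move: aE A' => -> A'; split => //.
have := arcs_iface A; have := arcs_iface A'.
by case: (d) (d') => -[] // h1 h2; case: (@inp_outp N N_opn a).
Qed.

Lemma arcs_dir t d p a q :
  arcs_of N t d p a q -> dir N t = if d then Send else Receive.
Proof.
move=> A; rewrite /dir; have ai := arcs_iface A.
case: asboolP => [[x [tx ox]]|no].
  case: d A ai => // A ai.
  case/(arcs_out A): tx => [E|[]//].
  by case: (pl_outp N_opn (arcs_dst A)); rewrite -E.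
case: d A ai => A ai.
  by case: no; exists a; split => //; apply/(arcs_out A); right.
case: asboolP => // -[]; exists a; split => //; apply/(arcs_in A); by right.
Qed.

Lemma move_dst d p a q : move N d p a q -> pl N q.
Proof. by case=> t /arcs_dst. Qed.

Lemma move_iface d p a q : move N d p a q -> iface N a.
Proof. by case=> t /arcs_iface; case: d; [right|left]. Qed.

Lemma fin_no_move f d a q : fin N = [set f] -> move N d f a q -> False.
Proof.
case: N_port => _ _ [i [f' [[_ fP _] _ ->]]] _ _ ff [t A].
have {ff} fE : [set f] f' by rewrite -ff.
move: fE A => <- {f} A.
have [plf] : [set x | net_pl (skeleton N) x
    /\ postset (net_flow (skeleton N)) x = set0] f' by rewrite fP.
move=> /seteqP[+ _] => /(_ t); apply; apply/skel_flow; split.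
  by apply/(arcs_in A); left.
by left; split; [exact: (arcs_src A)|exact: (arcs_tr A)].
Qed.

(** Directions may alternate here, unlike in a [run], which stands for pending messages of one
    sender. *)
Inductive moves : U -> U -> Prop :=
| moves_refl x : moves x x
| moves_step x d a y z : move N d x a y -> moves y z -> moves x z.

Lemma moves_fin x f : fin N = [set f] -> pl N x -> moves x f.
Proof.
case: N_port => _ _ [i [f' [[_ fP onp] _ ->]]] _ _ ff.
have {ff} fE : [set f] f' by rewrite -ff.
move: fE => <- {f} plx.
have plf : pl N f' by have := erefl : [set f'] f'; rewrite -fP => -[].
have [s [pth lst xs]] := onp x (or_introl plx).
move: xs => /splitPl E; case: E pth lst => s1 s2 lE.
rewrite /is_path cat_path last_cat lE => /andP[_] {s1 lE i onp}.
(* A skeleton path alternates places and transitions, so each round strips two nodes and the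
   induction is on a bound for the length. *)
have [k] := ubnP (size s2); elim: k x s2 plx => // k IH x [|t [|q s3]] plx /=.
- by move=> _ _ ->; left.
- rewrite andbT => _ /set_mem /skel_flow[xt] [[_ tt]|[tx _]] E.
    by subst t; case: (place_tr N_opn (or_introl plf) tt).
  by case: (place_tr N_opn (or_introl plx) tx).
- move=> sk /and3P[/set_mem /skel_flow[xt _] /set_mem /skel_flow[tq tqs] pth] lst.
  have [d [a [q' A]]] := post_move plx xt.
  have plq : pl N q.
    by case: tqs => -[] // plt; case: (place_tr N_opn (or_introl plt) (arcs_tr A)).
  apply: (@moves_step x d a q).
    exists t; have [->//|[_ E]] := (arcs_out A _).1 tq.
    case: (pl_iface N_opn plq); rewrite E; have := arcs_iface A.
    by case: (d); [right|left].
  by apply: IH pth lst => //; lia.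
Qed.

End Portnet.

Fixpoint run N d p (s : seq U) q : Prop :=
  if s is a :: s' then exists2 p', move N d p a p' & run N d p' s' q
  else p = q.

Lemma run_rcons N d p s q a r :
  run N d p s q -> move N d q a r -> run N d p (rcons s a) r.
Proof.
elim: s p => [|b s IH] p /=; first by move=> -> ?; exists r.
by case=> p' pp' /IH h /h; exists p'.
Qed.

(** * Consequences of observable choices, diamonds and loops *)

Section WellFormed.
Variable N : opn U Lb.
Hypothesis N_wf : well_formed N.

Let N_port : labeled_portnet N. Proof. by case: N_wf. Qed.
Let N_opn : is_opn N. Proof. by case: N_port. Qed.

Lemma run_iface d p s q a : run N d p s q -> a \in s ->
  if d then outp N a else inp N a.
Proof.
elim: s p => // b s IH p /= [p' [t /arcs_iface bi] /IH].
by rewrite inE => h /orP[/eqP ->|/h].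
Qed.

(** A common interface place forces equal labels, and observable choices then leave a single
    transition. *)
Lemma move_inj d p a q d' q' :
  move N d p a q -> move N d' p a q' -> d = d' /\ q = q'.
Proof.
move=> [t A] [t' A']; have sl := arcs_same_label N_port A A'.
have tE : t = t'.
  apply: contrapT => ne; case: N_wf => _ oc _ _.
  apply: (oc p t t') sl => //; first exact: arcs_src A.
    by apply/(arcs_in A); left.
  by apply/(arcs_in A'); left.
by subst t'; case: (arcs_inj N_port A A').
Qed.

Lemma diamond d p a q b r :
  move N d p a q -> move N (~~ d) p b r ->
  exists2 z, move N (~~ d) q b z & move N d r a z.
Proof.
move=> [t A] [t' A']; case: N_wf => _ _ dp _.
have [|||||] := dp p t t' (arcs_src A) _ _ _ q r.
- by apply/(arcs_in A); left.
- by apply/(arcs_in A'); left.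
- by rewrite (arcs_dir N_port A) (arcs_dir N_port A'); case: (d).
- by split; [apply/(arcs_out A); left|exact: arcs_dst A].
- by split; [apply/(arcs_out A'); left|exact: arcs_dst A'].
move=> u [u' [qu ru [z [uz u'z]] tu' t'u]].
have [du [au [zu Au]]] := post_move N_port (arcs_dst A) qu.
have [du' [au' [zu' Au']]] := post_move N_port (arcs_dst A') ru.
have [aE dE] := same_label_arcs N_port A Au' tu'.
have [aE' dE'] := same_label_arcs N_port A' Au t'u.
subst au' du' au du.
(* The common output is a place of the skeleton: otherwise an interface place would be internal, or
   both closing moves would send, although their directions are opposite. *)
have [zE|[d0 zE]] := (arcs_out Au _).1 uz;
have [zE'|[d0' zE']] := (arcs_out Au' _).1 u'z.
- by subst zu zu'; exists z; [exists u|exists u'].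
- by subst z zu; case: (pl_iface N_opn (arcs_dst Au));
    apply: (@move_iface N _ _ _ _ (ex_intro _ _ A)).
- by subst z zu'; case: (pl_iface N_opn (arcs_dst Au'));
    apply: (@move_iface N _ _ _ _ (ex_intro _ _ A')).
- by case: (d) d0 d0'.
Qed.

(** Diamonds are pasted along the run. A new message thus leaves the opposite pending run in place
    and prolongs its own run at the shifted common endpoint. *)
Lemma diamond_run d p a q s r :
  move N d p a q -> run N (~~ d) p s r ->
  exists2 z, run N (~~ d) q s z & move N d r a z.
Proof.
elim: s p q => [|b s IH] p q pq /=; first by move=> <-; exists q.
case=> p' pp' /IH; have [z qz p'z] := diamond pq pp'.
by move=> /(_ _ p'z) [w zw rw]; exists w => //; exists z.
Qed.

(** Cuts the run at the first occurrence of [a] and spells it out as a path of the net, in the shape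
    that the loop property asks for. *)
Lemma run_loop t d p a q0 q s z :
  arcs_of N t d p a q0 -> run N d q s z -> a \in s ->
  exists ps sigma u, [/\ is_path (flow N) q ps,
    [seq x <- ps | x \in tr N] = rcons sigma u,
    same_label N u N t,
    forall x, x \in sigma -> ~ same_label N x N t &
    forall x, x \in rcons sigma u -> dir N x = dir N t].
Proof.
move=> A; elim: s q => // b s IH q /= [q1 [u Au] q1z].
have qu : (q, u) \in flow N by rewrite inE; apply/(arcs_in Au); left.
have uq1 : (u, q1) \in flow N by rewrite inE; apply/(arcs_out Au); left.
have trq1 : (q1 \in tr N) = false.
  apply/negP; rewrite inE => /(place_tr N_opn (or_introl (arcs_dst Au))) //.
have tru : u \in tr N by rewrite inE; exact: arcs_tr Au.
have du : dir N u = dir N t by rewrite (arcs_dir N_port Au) (arcs_dir N_port A).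
rewrite inE; have [ab _|ab] := eqVneq a b; rewrite /=.
  subst b; exists [:: u], [::], u; split => //=.
  - by rewrite qu.
  - by rewrite tru.
  - exact: (arcs_same_label N_port Au A).
  - by move=> x; rewrite inE => /eqP->.
case/(IH q1 q1z) => ps [sg [v [pth flt sl nsl dv]]].
exists [:: u, q1 & ps], (u :: sg), v; split => //=.
- by rewrite qu uq1.
- by rewrite tru trq1 flt.
- move=> x; rewrite inE => /orP[/eqP-> /(same_label_arcs N_port Au A)[E]|/nsl //].
  by rewrite E eqxx in ab.
- by move=> x; rewrite inE => /orP[/eqP->|/dv].
Qed.

(** The loop property in terms of moves: on a run in one direction the next
    message of a given kind is always the first pending one. *)
Lemma run_head d p s z a q :
  run N d p s z -> move N d p a q -> a \in s ->
  exists2 s', s = a :: s' & run N d q s' z.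
Proof.
case: s => // b s /= [q' pq' qz] pq.
have [ab _|ab] := eqVneq a b.
  by subst b; exists s => //; have [_ ->] := move_inj pq pq'.
rewrite inE (negPf ab) /= => a_s; exfalso.
case: pq' => t A; case: pq => t' A'.
(* If another message came first, the run up to the first [a] would be a path as in the loop
   property, which demands a change of direction on it; but all its transitions have the direction
   of [t]. *)
have [ps [sg [u [pth flt sl nsl du]]]] := run_loop A' qz a_s.
have dt : dir N t = dir N t' by rewrite (arcs_dir N_port A) (arcs_dir N_port A').
have tt' : t <> t'.
  move=> tE; subst t'; have [_ _ E _] := arcs_inj N_port A A'.
  by rewrite E eqxx in ab.
have tru : t \in tr N by rewrite inE; exact: arcs_tr A.
have trq' : (q' \in tr N) = false.
  apply/negP; rewrite inE => /(place_tr N_opn (or_introl (arcs_dst A))) //.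
have lp : loop_property N by case: N_wf.
have [||||x [xs xt]] := lp p t t' (arcs_src A) _ _ tt' dt
  (t :: q' :: ps) sg u _ _ sl nsl.
- by apply/(arcs_in A); left.
- by apply/(arcs_in A'); left.
- rewrite /is_path /= -/(is_path _ _ _) pth andbT; apply/andP;
  by split; rewrite inE; [apply/(arcs_in A)|apply/(arcs_out A)]; left.
- by rewrite /= tru trq' flt.
apply; have : x \in [seq x <- [:: t, q' & ps] | x \in tr N].
  by rewrite mem_filter xs andbT inE.
by rewrite /= tru trq' flt inE dt => /orP[/eqP->|/du].
Qed.

End WellFormed.

(** * Moves of a mirror, seen in [N] *)

Section Mirror.
Variables (N M : opn U Lb) (phi : U -> U).
Hypothesis N_port : labeled_portnet N.
Hypothesis M_mirror : partial_mirror N M phi.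
Hypothesis M_glue : forall x, iface M x -> phi x = x.

Let N_opn : is_opn N. Proof. by case: N_port. Qed.
Lemma mirror_port : labeled_portnet M. Proof. by case: M_mirror. Qed.
Let M_opn : is_opn M. Proof. by case: mirror_port. Qed.

Lemma mirror_inp x : inp M x -> outp N x.
Proof.
case: M_mirror => _ _ [_ _ h _] _ _ ix; apply: h.
by exists x => //; apply: M_glue; left.
Qed.

Lemma mirror_outp x : outp M x -> inp N x.
Proof.
case: M_mirror => _ _ [_ _ _ h] _ _ ix; apply: h.
by exists x => //; apply: M_glue; right.
Qed.

Lemma mirror_iface x : iface M x -> iface N x.
Proof. by case=> [/mirror_inp|/mirror_outp]; [right|left]. Qed.

Lemma mirror_pl x : pl M x -> pl N (phi x).
Proof. by case: M_mirror => _ _ [h _ _ _] _ _ px; apply: h; exists x. Qed.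

(** [phi] keeps the skeleton arcs but reverses the interface arc, whence the negated direction; the
    message keeps its name because [phi] fixes the interface places of [M]. *)
Lemma mirror_arcs t d p a q :
  arcs_of M t d p a q -> arcs_of N (phi t) (~~ d) (phi p) a (phi q).
Proof.
move=> A; case: (M_mirror) => _ _ [_ trM _ _] flM _.
have tt := arcs_tr A.
have ttN : tr N (phi t) by apply: trM; exists t.
have ioP x : pl M x \/ tr M x -> ~ inp M x /\ ~ outp M x.
  case=> [px|tx]; split.
  - by move=> ix; apply: (pl_inp M_opn px ix).
  - by move=> ix; apply: (pl_outp M_opn px ix).
  - by move=> ix; apply: (place_tr M_opn _ tx); right; left.
  - by move=> ix; apply: (place_tr M_opn _ tx); right; right.
have [ip op] := ioP p (or_introl (arcs_src A)).
have [iq oq] := ioP q (or_introl (arcs_dst A)).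
have [it ot] := ioP t (or_intror tt).
have pt : flow N (phi p, phi t).
  by apply: (flM p t _).1 => //; apply/(arcs_in A); left.
have tq : flow N (phi t, phi q).
  by apply: (flM t q _).1 => //; apply/(arcs_out A); left.
have [d' [a' [q' A']]] := post_move N_port (mirror_pl (arcs_src A)) pt.
have qE : phi q = q'.
  have [//|[_ E]] := (arcs_out A' _).1 tq.
  case: (pl_iface N_opn (mirror_pl (arcs_dst A))); rewrite E.
  by have := arcs_iface A'; case: (d'); [right|left].
rewrite qE; have ai := arcs_iface A.
have aN : iface N a by case: (d) ai => [/mirror_outp|/mirror_inp]; [left|right].
have phia : phi a = a by apply: M_glue; case: (d) ai; [right|left].
suff [dE aE] : ~~ d = d' /\ a = a' by rewrite dE aE.
case: d A ai => A ai.
  have : flow N (phi a, phi t).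
    apply: (flM t a _).2; last by right.
    by apply/(arcs_out A); right.
  rewrite phia => /(arcs_in A')[E|[/negPf-> ->]] //.
  by case: (pl_iface N_opn (arcs_src A')); rewrite -E.
have : flow N (phi t, phi a).
  apply: (flM a t _).2; last by left.
  by apply/(arcs_in A); right.
rewrite phia => /(arcs_out A')[E|[-> ->]] //.
by case: (pl_iface N_opn (arcs_dst A')); rewrite -E.
Qed.

Lemma mirror_move d p a q : move M d p a q -> move N (~~ d) (phi p) a (phi q).
Proof. by case=> t /mirror_arcs; exists (phi t). Qed.

(** Only sends of [N] lift: a mirror must accept whatever [N] can send, but it may omit some of its
    own sends. *)
Lemma mirror_send p a q : pl M p -> move N true (phi p) a q ->
  exists2 q', move M false p a q' & phi q' = q.
Proof.
move=> plp [t A]; case: (M_mirror) => _ _ _ _ [_ _ _ snd].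
have [||t' pt' tE] := snd p t plp.
- by apply/(arcs_in A); left.
- by rewrite (arcs_dir N_port A).
have [d' [a' [q' A']]] := post_move mirror_port plp pt'.
have := mirror_arcs A'; rewrite tE => /(arcs_inj N_port A)[dE _ aE qE].
exists q' => //; exists t'; rewrite aE; by case: d' dE A'.
Qed.

Lemma mirror_ini x y : ini M = [set x] -> ini N = [set y] -> phi x = y.
Proof.
case: M_mirror => _ _ _ _ [E _ _ _] xE yE.
by have : ini N (phi x); rewrite -?E ?xE ?yE //; [exists x|rewrite -xE E yE].
Qed.

Lemma mirror_fin x y : fin M = [set x] -> fin N = [set y] -> phi x = y.
Proof.
case: M_mirror => _ _ _ _ [_ E _ _] xE yE.
by have : fin N (phi x); rewrite -?E ?xE ?yE //; [exists x|rewrite -xE E yE].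
Qed.

End Mirror.
End Portnets.

Lemma perm_rem_mid (T : eqType) (h s r : seq T) a :
  perm_eq h (s ++ a :: r) -> perm_eq (rem a h) (s ++ r).
Proof.
move=> hp; have ah : a \in h by rewrite (perm_mem hp) mem_cat mem_head orbT.
rewrite -(perm_cons a) perm_sym (permPr (_ : perm_eq _ h)).
  by rewrite perm_sym (permPl hp) perm_catC /= perm_cons perm_catC.
by rewrite perm_sym perm_to_rem.
Qed.

(** * Configurations of the composed net *)

Section Dynamics.
Variables (U : eqType) (Lb : Type) (n : nat).
Variables (N : opn U Lb) (M : 'I_n -> opn U Lb) (phi : 'I_n -> U -> U).
Variables (iN fN : U) (iM fM : 'I_n -> U).

(** The nodes of the composed net: those of the pattern, those of the
    skeletons of [N] and of the mirrors, and the interface places of [N]. *)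
Inductive node :=
| NE of sync_node n
| NN of U
| NM of 'I_n & U
| NI of U.

(** Server and clients are state machines, so one marked place describes each of them; the refined
    places give way to [SN] and [CM]. *)
Inductive server := SI | SP | SN of U | SR.
Inductive client := CI | CP | CM of U | CR.

(** [n1], [n2], [n3] count the tokens on [a1], [a2], [a3]; [ch] lists those on
    the interface places of [N]. *)
Record config := Config {
  sv : server;
  cl : 'I_n -> client;
  n1 : nat;
  n2 : nat;
  n3 : nat;
  ch : seq U }.

Definition upd (c : 'I_n -> client) j v : 'I_n -> client :=
  fun k => if k == j then v else c k.

Definition edge_pre (d : bool) p a : seq node :=
  p :: (if d then [::] else [:: NI a]).
Definition edge_post (d : bool) q a : seq node :=
  q :: (if d then [:: NI a] else [::]).
Definition transfer (d : bool) (a : U) h := if d then a :: h else rem a h.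

(** The lists of consumed and produced nodes are recorded in order to match a step with a transition
    of the composed net. *)
Inductive gstep : config -> seq node -> seq node -> config -> Prop :=
| gstep_u c k1 k2 k3 h :
    gstep (Config SI c k1.+1 k2 k3 h) [:: NE Si; NE A1] [:: NE Sp]
          (Config SP c k1 k2 k3 h)
| gstep_v c k1 k2 k3 h :
    gstep (Config SP c k1 k2 k3 h) [:: NE Sp] [:: NN iN; NE A2]
          (Config (SN iN) c k1 k2.+1 k3 h)
| gstep_w c k1 k2 k3 h :
    gstep (Config (SN fN) c k1 k2 k3.+1 h) [:: NN fN; NE A3] [:: NE Sr]
          (Config SR c k1 k2 k3 h)
| gstep_t c k1 k2 k3 h :
    gstep (Config SR c k1 k2 k3 h) [:: NE Sr] [:: NE Si]
          (Config SI c k1 k2 k3 h)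
| gstep_N c k1 k2 k3 h d p a q :
    move N d p a q -> d || (a \in h) ->
    gstep (Config (SN p) c k1 k2 k3 h)
          (edge_pre d (NN p) a) (edge_post d (NN q) a)
          (Config (SN q) c k1 k2 k3 (transfer d a h))
| gstep_cu s c k1 k2 k3 h j :
    c j = CI ->
    gstep (Config s c k1 k2 k3 h) [:: NE (Ci j)] [:: NE (Cp j); NE A1]
          (Config s (upd c j CP) k1.+1 k2 k3 h)
| gstep_cv s c k1 k2 k3 h j :
    c j = CP ->
    gstep (Config s c k1 k2.+1 k3 h) [:: NE (Cp j); NE A2] [:: NM j (iM j)]
          (Config s (upd c j (CM (iM j))) k1 k2 k3 h)
| gstep_cw s c k1 k2 k3 h j :
    c j = CM (fM j) ->
    gstep (Config s c k1 k2 k3 h) [:: NM j (fM j)] [:: NE (Cr j); NE A3]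
          (Config s (upd c j CR) k1 k2 k3.+1 h)
| gstep_M s c k1 k2 k3 h j d p a q :
    c j = CM p -> move (M j) d p a q -> d || (a \in h) ->
    gstep (Config s c k1 k2 k3 h)
          (edge_pre d (NM j p) a) (edge_post d (NM j q) a)
          (Config s (upd c j (CM q)) k1 k2 k3 (transfer d a h)).

Definition greach : config -> config -> Prop :=
  clos_refl_trans config (fun g g' => exists pre post, gstep g pre post g').

Lemma greach_step g pre post g' : gstep g pre post g' -> greach g g'.
Proof. by move=> st; apply: rt_step; exists pre, post. Qed.

Lemma upd_eq c j v : upd c j v j = v.
Proof. by rewrite /upd eqxx. Qed.

Lemma upd_neq c j v k : k != j -> upd c j v k = c k.
Proof. by rewrite /upd => /negPf->. Qed.

Lemma upd_id c j : upd c j (c j) = c.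
Proof. by apply: funext => k; rewrite /upd; case: eqP => [->|]. Qed.

Lemma upd_upd c j v w : upd (upd c j v) j w = upd c j w.
Proof. by apply: funext => k; rewrite /upd; case: eqP. Qed.

(** Additive on both sides, since subtraction on [nat] truncates. *)
Lemma sum_upd (F : 'I_n -> client -> nat) c j v :
  \sum_k F k (upd c j v k) + F j (c j) = \sum_k F k (c k) + F j v.
Proof.
rewrite (bigD1 j) //= upd_eq [in RHS](bigD1 j) //=.
rewrite (eq_bigr (fun k => F k (c k))) => [|k kj]; last by rewrite upd_neq.
lia.
Qed.

Definition idle (c : 'I_n -> client) := forall j y, c j <> CM y.
Definition is_waiting v := if v is CP then true else false.
Definition waiting (c : 'I_n -> client) : nat := \sum_j is_waiting (c j).

Lemma waiting_upd c j v :
  waiting (upd c j v) + is_waiting (c j) = waiting c + is_waiting v.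
Proof. exact: (sum_upd (fun _ v => is_waiting v : nat)). Qed.

Lemma idle_upd c j v : (forall k y, k != j -> c k <> CM y) ->
  (forall y, v <> CM y) -> idle (upd c j v).
Proof. by move=> ic vM k y; rewrite /upd; case: eqP => // /eqP; apply: ic. Qed.

(** Clients in [CP] account for the tokens on [a1], up to the request being
    served. While [N] is at [x] and the active mirror at [y], the messages in
    transit are those of a run of sends [al] of [N] from [phi y] and of a run
    of receives [be] of [N] from [x], with a common endpoint [z]. *)
Definition opening c k1 k2 k3 h x :=
  [/\ idle c, waiting c = k1.+1, k2 = 1, k3 = 0
    & exists2 al, run N true iN al x & perm_eq h al].

Definition talking c k1 k2 k3 h x :=
  [/\ waiting c = k1, k2 = 0, k3 = 0
    & exists j y, [/\ c j = CM y, pl (M j) y,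
        forall k y', k != j -> c k <> CM y'
      & exists al be z, [/\ run N false x be z, run N true (phi j y) al z
                          & perm_eq h (al ++ be)]]].

Definition closing c k1 k2 k3 h x :=
  [/\ idle c, waiting c = k1, k2 = 0, k3 = 1
    & exists2 be, run N false x be fN & perm_eq h be].

(** While the server is inside [N], exactly one of these is present: a token on [a2], an active
    mirror, a token on [a3]. Elsewhere there is none, and nothing is in transit between [N] and the
    mirrors. *)
Definition coherent (g : config) : Prop :=
  let: Config s c k1 k2 k3 h := g in
  match s with
  | SI | SR => [/\ idle c, waiting c = k1, k2 = 0, k3 = 0 & h = [::]]
  | SP => [/\ idle c, waiting c = k1.+1, k2 = 0, k3 = 0 & h = [::]]
  | SN x => pl N x /\ [\/ opening c k1 k2 k3 h x, talking c k1 k2 k3 h x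
                         | closing c k1 k2 k3 h x]
  end.

(** * Invariance of coherence *)

Hypothesis N_wf : well_formed N.
Hypothesis M_mirror : forall j, partial_mirror N (M j) (phi j).
Hypothesis M_glue : forall j x, iface (M j) x -> phi j x = x.
Hypotheses (iN_ini : ini N = [set iN]) (fN_fin : fin N = [set fN]).
Hypotheses (iM_ini : forall j, ini (M j) = [set iM j])
           (fM_fin : forall j, fin (M j) = [set fM j]).

Let N_port : labeled_portnet N. Proof. by case: N_wf. Qed.
Let N_opn : is_opn N. Proof. by case: N_port. Qed.

Let iN_pl : pl N iN. Proof. exact: ini_pl iN_ini. Qed.

Let iM_pl j : pl (M j) (iM j).
Proof. by apply: ini_pl (iM_ini j); case: (mirror_port (M_mirror j)). Qed.

Lemma phi_ini j : phi j (iM j) = iN.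
Proof. exact (mirror_ini (M_mirror j) (iM_ini j) iN_ini). Qed.

Lemma phi_fin j : phi j (fM j) = fN.
Proof. exact (mirror_fin (M_mirror j) (fM_fin j) fN_fin). Qed.

Lemma run_fin d s z : run N d fN s z -> s = [::] /\ z = fN.
Proof. by case: s => [->//|a s [q /(fin_no_move N_port fN_fin)]]. Qed.

(** The two directions use disjoint sets of interface places, so a received message cannot come from
    the wrong run. *)
Lemma run_other d p s q p' a q' : run N d p s q -> move N (~~ d) p' a q' ->
  a \in s = false.
Proof.
move=> r [t /arcs_iface ai]; apply/negP => /(run_iface r).
by case: d ai {r} => /= h1 h2; case: (@inp_outp U Lb N N_opn a).
Qed.

Lemma idle_cu c j : c j = CI -> idle c ->
  idle (upd c j CP) /\ waiting (upd c j CP) = (waiting c).+1.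
Proof.
move=> cj ic; split; first by apply: idle_upd.
by have := waiting_upd c j CP; rewrite cj /=; lia.
Qed.

Lemma coherent_step g pre post g' :
  coherent g -> gstep g pre post g' -> coherent g'.
Proof.
move=> + st; case: st => {g pre post g'}.
- by move=> c k1 k2 k3 h [].
- move=> c k1 k2 k3 h [ic w -> -> ->]; split; first exact: iN_pl.
  by apply: Or31; split => //; exists [::].
- move=> c k1 k2 k3 h [_].
  (* A token on [a3] means the closing phase, and the run [be] from [fN] is empty: nothing is in
     transit when [w] fires. *)
  case=> [[_ _ _ //]|[_ _ //]|[ic w -> [->] [be /run_fin[-> _]]]].
  by move=> /perm_nilP.
- by move=> c k1 k2 k3 h [].
- move=> c k1 k2 k3 h d p a q pq ah [_ I]; split; first exact: move_dst pq.
  case: I => [[ic w -> -> [al r hp]]|[w -> -> [j [y [cj py oth]]]]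
             |[ic w -> -> [be r hp]]].
  (* A send prolongs [al]; a receive is impossible, as only messages of [N] are pending. *)
  + apply: Or31; split => //; case: d pq ah => pq /=.
      exists (rcons al a); first exact: run_rcons pq.
      by rewrite perm_sym perm_rcons perm_cons perm_sym.
    by rewrite (perm_mem hp) (@run_other true _ _ _ _ _ _ r pq).
  (* A send commutes past [be] and prolongs [al]. A received message lies in [be], and is its first
     one by [run_head]. *)
  + move=> [al [be [z [r r' hp]]]]; apply: Or32; split => //.
    exists j, y; split => //; case: d pq ah => pq /=.
      have [z' qz' zz'] := diamond_run N_wf pq r.
      exists (rcons al a), be, z'; split => //; first exact: run_rcons zz'.
      by rewrite cat_rcons -(cat1s a be) perm_sym perm_catCA /= perm_cons perm_sym.
    rewrite (perm_mem hp) mem_cat (@run_other true _ _ _ _ _ _ r' pq) //=.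
    case/(run_head N_wf r pq) => be' bE qz; exists al, be', z; split => //.
    by apply: perm_rem_mid; rewrite -bE.
  (* A send would commute past [be] and yield a move out of [fN]. *)
  + apply: Or33; split => //; case: d pq ah => pq /=.
      by have [z' _ /(fin_no_move N_port fN_fin)] := diamond_run N_wf pq r.
    rewrite (perm_mem hp) => /(run_head N_wf r pq)[be' bE qz].
    by exists be' => //; apply: (@perm_rem_mid _ _ [::]); rewrite -bE.
- move=> s c k1 k2 k3 h j cj; have w := waiting_upd c j CP.
  have {w} wE k : waiting c = k -> waiting (upd c j CP) = k.+1.
    by move: w; rewrite cj /=; lia.
  have ic : idle c -> idle (upd c j CP) by move=> ic; apply: idle_upd.
  case: s => [||x|] /=; try by case=> /ic ? /wE.
  case=> px [[/ic ? /wE w *]|[/wE w -> -> [l [y [cl py oth r]]]]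
            |[/ic ? /wE w *]]; split => //.
  + exact: Or31.
  + apply: Or32; split => //; exists l, y.
    have lj : l != j by apply/eqP => E; rewrite E cj in cl.
    split => //; first by rewrite upd_neq.
    by move=> k y' kl; rewrite /upd; case: ifP => // _; apply: oth.
  + exact: Or33.
- move=> s c k1 k2 k3 h j cj; have w := waiting_upd c j (CM (iM j)).
  case: s => [||x|] /=; try by case.
  case=> px [[ic wk [->] -> [al r hp]]|[_ //]|[_ _ //]]; split => //.
  apply: Or32; split => //; first by move: w; rewrite cj /=; lia.
  exists j, (iM j); split; [by rewrite upd_eq|exact: iM_pl| |].
    by move=> l y lj; rewrite upd_neq.
  (* The client has sent nothing yet, so [be] is empty; [al] starts at the right place because
     [phi j] maps [iM j] to [iN]. *)
  by exists al, [::], x; rewrite cats0 phi_ini.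
- move=> s c k1 k2 k3 h j cj; have w := waiting_upd c j CR.
  have nidle : ~ idle c by move=> /(_ j _ cj).
  case: s => [||x|] /=; try by case.
  case=> px [[//]|[wk -> -> [l [y [cl py oth [al [be [z [r r' hp]]]]]]]]|[//]].
  split => //; apply: Or33.
  have [lj|jl] := eqVneq j l; last by case: (oth _ _ jl cj).
  subst l.
  move: cl; rewrite cj => -[yE]; subst y.
  (* No run leaves [fN], so [al] is empty and [be] ends at [fN]. *)
  move: r'; rewrite phi_fin => /run_fin[alE zE]; subst al z.
  split => //; last by exists be.
    by apply: idle_upd.
  by move: w; rewrite cj /=; lia.
- move=> s c k1 k2 k3 h j d p a q cj pq ah; have w := waiting_upd c j (CM q).
  have nidle : ~ idle c by move=> /(_ j _ cj).
  case: s => [||x|] /=; try by case.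
  case=> px [[//]|[wk -> -> [l [y [cl py oth [al [be [z [r r' hp]]]]]]]]|[//]].
  have [lj|jl] := eqVneq j l; last by case: (oth _ _ jl cj).
  subst l.
  move: cl; rewrite cj => -[yE]; subst y.
  split => //; apply: Or32; split => //; first by move: w; rewrite cj /=; lia.
  exists j, q; split; first by rewrite upd_eq.
  - exact: move_dst pq.
  - by move=> k y' kj; rewrite upd_neq //; apply: oth.
  (* Through [phi j] this is a move of [N] in the opposite direction, so the cases are those of a
     move of [N] with [al] and [be] exchanged. *)
  have pqN := mirror_move N_port (M_mirror j) (@M_glue j) pq.
  case: d pq pqN ah => pq /= pqN.
    have [z' qz' zz'] := diamond_run N_wf pqN r'.
    exists al, (rcons be a), z'; split => //; first exact: run_rcons zz'.
    by rewrite -rcons_cat perm_sym perm_rcons perm_cons perm_sym.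
  rewrite (perm_mem hp) mem_cat (@run_other false _ _ _ _ _ _ r pqN) orbF.
  case/(run_head N_wf r' pqN) => al' aE qz; exists al', be, z; split => //.
  by apply: (@perm_rem_mid _ _ [::]); rewrite -cat_cons -aE.
Qed.

(** * Reaching the final configuration *)

Lemma greach_trans g1 g2 g3 : greach g1 g2 -> greach g2 g3 -> greach g1 g3.
Proof. exact: rt_trans. Qed.

(** The rest [r] of the channels stays untouched, so that the two runs can be emptied one after the
    other. *)
Lemma drain_N c k1 k2 k3 x be z h r :
  run N false x be z -> perm_eq h (be ++ r) ->
  exists2 h', perm_eq h' r &
    greach (Config (SN x) c k1 k2 k3 h) (Config (SN z) c k1 k2 k3 h').
Proof.
elim: be x h => [|a be IH] x h /=.
  by move=> <- hr; exists h => //; exact: rt_refl.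
move=> [y xy yz] hp; have ah : a \in h by rewrite (perm_mem hp) mem_head.
have [h' hr' re] := IH y (rem a h) yz (@perm_rem_mid _ _ [::] _ _ hp).
exists h' => //; apply: greach_trans re.
exact: greach_step (gstep_N c k1 k2 k3 xy ah).
Qed.

Lemma drain_M s c k1 k2 k3 j y al z h r :
  c j = CM y -> pl (M j) y -> run N true (phi j y) al z -> perm_eq h (al ++ r) ->
  exists h' y', [/\ perm_eq h' r, phi j y' = z, pl (M j) y' &
    greach (Config s c k1 k2 k3 h) (Config s (upd c j (CM y')) k1 k2 k3 h')].
Proof.
elim: al y c h => [|a al IH] y c h cj py /=.
  by move=> yz hr; exists h, y; split => //; rewrite -cj upd_id; exact: rt_refl.
move=> [p yp pz] hp; have ah : a \in h by rewrite (perm_mem hp) mem_head.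
have [q yq qE] := mirror_send N_port (M_mirror j) (@M_glue j) py yp; subst p.
have [h' [y' [hr' y'z py' re]]] := IH q (upd c j (CM q)) (rem a h)
  (upd_eq _ _ _) (move_dst yq) pz (@perm_rem_mid _ _ [::] _ _ hp).
exists h', y'; split => //; rewrite upd_upd in re; apply: greach_trans re.
exact: greach_step (gstep_M s k1 k2 k3 cj yq ah).
Qed.

(** For each move the sender fires first and the receiver takes the message at once, so the channels
    are empty again. *)
Lemma talk_moves c k1 k2 k3 j y f :
  c j = CM y -> moves (M j) y f ->
  greach (Config (SN (phi j y)) c k1 k2 k3 [::])
         (Config (SN (phi j f)) (upd c j (CM f)) k1 k2 k3 [::]).
Proof.
move=> + ms; elim: ms c => {y f} [f|y d a p f yp _ IH] c cj.
  by rewrite -cj upd_id; exact: rt_refl.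
have := IH (upd c j (CM p)) (upd_eq _ _ _); rewrite upd_upd.
apply: greach_trans.
have ypN := mirror_move N_port (M_mirror j) (@M_glue j) yp.
case: d yp ypN => yp ypN.
  apply: (greach_trans (greach_step (gstep_M _ k1 k2 k3 (h := [::]) cj yp isT))).
  have ah : false || (a \in [:: a]) by rewrite mem_head.
  by have := greach_step (gstep_N (upd c j (CM p)) k1 k2 k3 ypN ah); rewrite /= eqxx.
apply: (greach_trans (greach_step (gstep_N c k1 k2 k3 (h := [::]) ypN isT))).
have ah : false || (a \in [:: a]) by rewrite mem_head.
by have := greach_step (gstep_M (SN (phi j p)) k1 k2 k3 cj yp ah); rewrite /= eqxx.
Qed.

Lemma moves_fM j y : pl (M j) y -> moves (M j) y (fM j).
Proof. by apply: moves_fin; [exact: mirror_port|exact: fM_fin]. Qed.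

(** Decreases along the life of a client; the sum over all clients bounds the remaining rounds. *)
Definition client_rank v :=
  match v with CI => 3 | CP => 2 | CM _ => 1 | CR => 0 end.
Definition rank (c : 'I_n -> client) : nat := \sum_j client_rank (c j).

Lemma rank_upd c j v :
  rank (upd c j v) + client_rank (c j) = rank c + client_rank v.
Proof. exact: (sum_upd (fun _ => client_rank)). Qed.

Lemma settle_closing c k1 h x : closing c k1 0 1 h x ->
  greach (Config (SN x) c k1 0 1 h) (Config SI c k1 0 0 [::]).
Proof.
move=> [ic w _ _ [be r hp]].
have hp' : perm_eq h (be ++ [::]) by rewrite cats0.
have [h' /perm_nilP -> re] := drain_N c k1 0 1 r hp'.
apply: (greach_trans re); apply: greach_trans (greach_step (gstep_t _ _ _ _ _)).
exact: greach_step (gstep_w _ _ _ _ _).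
Qed.

Lemma settle_talking c k1 h x : talking c k1 0 0 h x ->
  exists c', [/\ idle c', waiting c' = k1, rank c' < rank c &
    greach (Config (SN x) c k1 0 0 h) (Config SI c' k1 0 0 [::])].
Proof.
move=> [wk _ _ [j [y [cj py oth [al [be [z [r r' hp]]]]]]]].
have w := waiting_upd c j CR; have rk := rank_upd c j CR.
have ic : idle (upd c j CR) by apply: idle_upd.
exists (upd c j CR); split => //; [|by rewrite cj /= in rk; lia|].
  by rewrite cj /= in w; lia.
have hp' : perm_eq h (be ++ al) by rewrite (permPl hp) perm_catC.
have [h1 hp1 re1] := drain_N c k1 0 0 r hp'.
have hp1' : perm_eq h1 (al ++ [::]) by rewrite cats0.
have [h2 [y' [/perm_nilP -> yz py' re2]]] := drain_M (SN z) k1 0 0 cj py r' hp1'.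
subst z; apply: (greach_trans re1); apply: (greach_trans re2).
have := talk_moves k1 0 0 (upd_eq c j (CM y')) (moves_fM py').
rewrite upd_upd phi_fin.
move=> re3; apply: (greach_trans re3).
have := greach_step (gstep_cw (SN fN) k1 0 0 [::] (upd_eq c j (CM (fM j)))).
rewrite upd_upd => re4; apply: (greach_trans re4); apply: settle_closing.
split => //; last by exists [::].
by rewrite cj /= in w; lia.
Qed.

Lemma waiting_client c k : waiting c = k.+1 -> exists j, c j = CP.
Proof.
move=> w; apply: contrapT => no; move: w; rewrite /waiting big1 // => j _.
by case cj: (c j) => //; case: no; exists j.
Qed.

Lemma settle_opening c k1 h x : pl N x -> opening c k1 1 0 h x ->
  exists c', [/\ idle c', waiting c' = k1, rank c' < rank c &
    greach (Config (SN x) c k1 1 0 h) (Config SI c' k1 0 0 [::])].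
Proof.
move=> px op; have [ic w _ _ _] := op; have [j cj] := waiting_client w.
have st := gstep_cv (SN x) k1 0 0 h cj.
have rk := rank_upd c j (CM (iM j)).
(* Invariance already describes the configuration after the client takes [a2]: with [a2] and [a3]
   empty, only the talking phase fits. *)
have I : coherent (Config (SN x) c k1 1 0 h) by split => //; apply: Or31.
have [_ [[]|/settle_talking|[]]] // := coherent_step I st.
move=> [c' [ic' w' rk' re]].
exists c'; split => //; first by rewrite cj /= in rk; lia.
exact: greach_trans (greach_step st) re.
Qed.

Definition final_config : config := Config SI (fun=> CR) 0 0 0 [::].

Lemma settle_idle c : idle c ->
  greach (Config SI c (waiting c) 0 0 [::]) final_config.
Proof.
have [m] := ubnP (rank c); elim: m c => // m IH c rk ic.
(* Clients that have not begun first send their request, which also lowers the rank. Then either a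
   client is waiting, and its round lowers the rank, or all are done. *)
have [[j cj]|noI] := pselect (exists j, c j = CI).
  have [ic' w'] := idle_cu cj ic; have rk' := rank_upd c j CP.
  apply: (greach_trans (greach_step (gstep_cu _ _ _ _ _ cj))).
  by rewrite -w'; apply: IH => //; rewrite cj /= in rk'; lia.
case w: (waiting c) => [|k].
  suff -> : c = (fun=> CR) by exact: rt_refl.
  apply: funext => j; case cj: (c j) => [||y|] //.
  - by case: noI; exists j.
  - by move: w; rewrite /waiting (bigD1 j) //= cj.
  - by case: (ic j y).
apply: (greach_trans (greach_step (gstep_u _ _ _ _ _))).
apply: (greach_trans (greach_step (gstep_v _ _ _ _ _))).
have op : opening c k 1 0 [::] iN by split => //; exists [::].
have [c' [ic' w' rk' re]] := settle_opening iN_pl op.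
by apply: (greach_trans re); rewrite -w'; apply: IH => //; lia.
Qed.

Lemma settle g : coherent g -> greach g final_config.
Proof.
have opn_final x c k h : pl N x -> opening c k 1 0 h x ->
    greach (Config (SN x) c k 1 0 h) final_config.
  move=> px /(settle_opening px)[c' [ic' w' _ re]].
  by apply: (greach_trans re); rewrite -w'; apply: settle_idle.
case: g => -[||x|] c k k2 k3 h /=.
- by case=> ic <- -> -> ->; apply: settle_idle.
- case=> ic w -> -> ->.
  apply: (greach_trans (greach_step (gstep_v _ _ _ _ _))).
  by apply: opn_final iN_pl _; split => //; exists [::].
- case=> px [I|I|I].
  + by have [_ _ E2 E3 _] := I; subst k2 k3; exact: opn_final.
  + have [_ E2 E3 _] := I; subst k2 k3.
    have [c' [ic' w' _ re]] := settle_talking I.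
    by apply: (greach_trans re); rewrite -w'; apply: settle_idle.
  + have [ic w E2 E3 _] := I; subst k2 k3.
    by apply: (greach_trans (settle_closing I)); rewrite -w; apply: settle_idle.
- case=> ic <- -> -> ->.
  apply: (greach_trans (greach_step (gstep_t _ _ _ _ _))).
  exact: settle_idle.
Qed.

End Dynamics.

Arguments NE {U n} _.
Arguments NN {U n} _.
Arguments NM {U n} _ _.
Arguments NI {U n} _.
Arguments SI {U}.
Arguments SP {U}.
Arguments SR {U}.
Arguments CI {U}.
Arguments CP {U}.
Arguments CR {U}.

Ltac in_sets := first [reflexivity | assumption | left; in_sets | right; in_sets].

(** * Markings of the composed net *)

Section Composition.
Variables (U : eqType) (Lb : Type) (n : nat).
Variables (N : opn U Lb) (M : 'I_n -> opn U Lb) (phi : 'I_n -> U -> U).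
Variables (e : sync_node n -> U) (lu lv lw lt : Lb).
Variables (iN fN : U) (iM fM : 'I_n -> U).

Notation S := (sync_server e lu lv lw lt).
Notation C := (sync_client e lu lv lw).
Notation node := (node U n).

(** Interface places of mirrors need no tag of their own: by the gluing they are interface places of
    [N]. *)
Definition dec (X : node) : U :=
  match X with NE k => e k | NN x => x | NM _ x => x | NI x => x end.

(** The refined places [q] and [q_j] are not nodes of the composed net. *)
Definition ok (X : node) : Prop :=
  match X with
  | NE k => match k with Sq | Cq _ => False | _ => True end
  | NN x => pl N x \/ tr N x
  | NM j x => pl (M j) x \/ tr (M j) x
  | NI x => iface N x
  end.

Hypothesis N_wf : well_formed N.
Hypothesis M_mirror : forall j, partial_mirror N (M j) (phi j).
Hypothesis M_glue : forall j x, iface (M j) x -> phi j x = x.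
Hypothesis M_disj : forall j k, j <> k -> disjoint_skeletons (M j) (M k).
Hypothesis e_inj : injective e.
Hypothesis S_skel : forall k, disjoint_skeletons S (M k).
Hypothesis C_skel : forall j, disjoint_skeletons (C j) N /\
     forall k, disjoint_skeletons (C j) (M k).
Hypothesis S_disj : disjoint_nodes S N.
Hypothesis C_disj : forall j, disjoint_nodes (C j) (M j).
Hypothesis L_share : forall X Y,
     refined_family e lu lv lw lt N M X -> refined_family e lu lv lw lt N M Y ->
     X <> Y -> share_only_interface X Y.
Hypotheses (iN_ini : ini N = [set iN]) (fN_fin : fin N = [set fN]).
Hypotheses (iM_ini : forall j, ini (M j) = [set iM j])
           (fM_fin : forall j, fin (M j) = [set fM j]).

Let N_port : labeled_portnet N. Proof. by case: N_wf. Qed.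
Let N_opn : is_opn N. Proof. by case: N_port. Qed.
Let M_port j : labeled_portnet (M j). Proof. exact: mirror_port (M_mirror j). Qed.
Let M_opn j : is_opn (M j). Proof. by case: (M_port j). Qed.

(** * Distinctness of the nodes of the composed net *)

Lemma nodesE (K : opn U Lb) x : nodes K x <-> pl K x \/ iface K x \/ tr K x.
Proof. by rewrite /nodes /net_nodes /iface /=; split=> [[[[]|]|]|[|[[]|]]]; in_sets. Qed.

Notation RS := (refined_server e lu lv lw lt N).
Notation RC := (refined_client e lu lv lw M).

Lemma share_iface j x : nodes RS x -> nodes (RC j) x ->
  iface RS x /\ iface (RC j) x.
Proof.
move=> xS xC; suff sh : share_only_interface RS (RC j).
  by have : (nodes RS `&` nodes (RC j)) x by []; rewrite sh.
apply: L_share; [by right|by left; exists j|].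
(* The server and a client are different nets because their initial places differ. *)
move=> /(congr1 (@ini _ _)) /= /seteqP[/(_ (e Si) erefl) + _].
by move=> /e_inj.
Qed.

Lemma server_nodes x : nodes N x -> nodes RS x.
Proof. by move=> /nodesE[|[[]|]] h; apply/nodesE; in_sets. Qed.

Lemma client_nodes j x : nodes (M j) x -> nodes (RC j) x.
Proof. by move=> /nodesE[|[[]|]] h; apply/nodesE; in_sets. Qed.

Lemma server_sync_disj (k : sync_node n) x : nodes N x ->
  match k with
  | Ci _ | Cp _ | Cq _ | Cr _ | Cu _ | Cv _ | Cw _ => False | _ => True
  end ->
  e k = x -> False.
Proof.
move=> xN kS kx; apply: (disj_in S_disj _ xN); rewrite -kx {kx xN}.
by apply/nodesE; case: k kS => // _; in_sets.
Qed.

Lemma iface_RC j x : nodes (M j) x -> iface (RC j) x -> iface (M j) x.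
Proof.
move=> xN; have no k : List.In k [:: A1; A2; A3] -> x = e k -> False.
  move=> kA xE; apply: (disj_in (@C_disj j) _ xN); rewrite xE.
  by apply/nodesE; case: kA => [<-|[<-|[<-|//]]]; in_sets.
by move=> [[/= xE|]|[/= [xE|xE]|]];
  [case: (no A2) => //; in_sets|left|case: (no A1) => //; in_sets
  |case: (no A3) => //; in_sets|right].
Qed.

Lemma skel_nodes (K : opn U Lb) x : pl K x \/ tr K x -> nodes K x.
Proof. by case=> h; apply/nodesE; in_sets. Qed.

Lemma skel_iface (K : opn U Lb) x :
  is_opn K -> pl K x \/ tr K x -> iface K x -> False.
Proof.
by move=> Ko [h|h] xI;
  [apply: (pl_iface Ko h xI)|apply: (place_tr Ko _ h); right].
Qed.

(** A common node is shared by the refined server and client, hence an interface place of the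
    client; as a node of [M j] it is then an interface place of [M j], outside its skeleton. *)
Lemma N_M_disj j x : nodes N x -> pl (M j) x \/ tr (M j) x -> False.
Proof.
move=> xN xM; have xM' := skel_nodes xM.
have [_ /(iface_RC xM')] := share_iface (server_nodes xN) (client_nodes xM').
exact: skel_iface.
Qed.

(** [S_disj] settles the server's nodes and [a1], [a2], [a3]. A client's own node lying in [N] would
    be shared, hence an interface place of the refined client, but it is none of [a1], [a2], [a3]
    and no node of [M j]. *)
Lemma sync_N k x : ok (NE k) -> nodes N x -> e k = x -> False.
Proof.
move=> kok xN kx; case: k kok kx => // [||||||||||j|j|j|j|j|j] _ kx;
  try by apply: (server_sync_disj xN _ kx).
all: have {}kx := esym kx.
all: have xC : nodes (RC j) x by
  rewrite kx; apply/nodesE; try (by right; right; in_sets);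
  by left; left; split; [in_sets|move=> /e_inj].
all: have [_ xI] := share_iface (server_nodes xN) xC.
all: have xC' : nodes (C j) x by rewrite kx; apply/nodesE; in_sets.
all: case: xI => [[/= /esym|]|[[/= /esym|/= /esym]|]];
  try by rewrite kx => /e_inj.
all: move=> xM; apply: (disj_in (@C_disj j) xC'); apply/nodesE; right; left.
all: by [left|right].
Qed.

Lemma sync_M k j x : ok (NE k) -> pl (M j) x \/ tr (M j) x -> e k = x -> False.
Proof.
move=> kok xM kx; case: k kok kx => // [||||||||||i|i|i|i|i|i] _ kx.
1-3: apply: (disj_in (@C_disj j) _ (skel_nodes xM)); rewrite -kx;
     apply/nodesE; in_sets.
1-7: apply: (disj_in (@S_skel j) _ xM); rewrite -kx; in_sets.
all: apply: (disj_in ((@C_skel i).2 j) _ xM); rewrite -kx; in_sets.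
Qed.

Lemma dec_inj X Y : ok X -> ok Y -> dec X = dec Y -> X = Y.
Proof.
have I_N x : iface N x -> nodes N x by move=> xI; apply/nodesE; in_sets.
case: X Y => [k|x|i x|x] [k'|y|j y|y] /= okX okY E.
- by rewrite (e_inj E).
- by case: (sync_N okX (skel_nodes okY) E).
- by case: (sync_M okX okY E).
- by case: (sync_N okX (I_N _ okY) E).
- by case: (sync_N okY (skel_nodes okX) (esym E)).
- by rewrite E.
- by subst y; case: (N_M_disj (skel_nodes okX) okY).
- by subst y; case: (skel_iface N_opn okX okY).
- by case: (sync_M okY okX (esym E)).
- by subst y; case: (N_M_disj (skel_nodes okY) okX).
- subst y; have [->//|/eqP ij] := eqVneq i j.
  by case: (disj_in (M_disj ij) okX okY).
- by subst y; case: (N_M_disj (I_N _ okY) okX).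
- by case: (sync_N okY (I_N _ okX) (esym E)).
- by subst y; case: (skel_iface N_opn okY okX).
- by subst y; case: (N_M_disj (I_N _ okX) okY).
- by rewrite E.
Qed.

(** * Arcs and transitions of the composed net *)

Definition server_arcs : seq (sync_node n * sync_node n) :=
  [:: (Si, Su); (A1, Su); (Su, Sp); (Sp, Sv); (Sv, Sq); (Sv, A2);
      (Sq, Sw); (A3, Sw); (Sw, Sr); (Sr, St); (St, Si)].

Definition client_arcs (j : 'I_n) : seq (sync_node n * sync_node n) :=
  [:: (Ci j, Cu j); (Cu j, Cp j); (Cu j, A1); (Cp j, Cv j); (A2, Cv j);
      (Cv j, Cq j); (Cq j, Cw j); (Cw j, Cr j); (Cw j, A3)].

Ltac in_cases H := repeat (destruct H as [H|H]); try contradiction.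

Lemma server_flow x y : flow S (x, y) <->
  exists k k', [/\ List.In (k, k') server_arcs, e k = x & e k' = y].
Proof.
split=> [/= H|[k [k' [/= H <- <-]]]].
  by in_cases H; case: H => -> ->;
     do 2 eexists; (split; [|reflexivity|reflexivity]); in_sets.
by in_cases H; case: H => <- <-; in_sets.
Qed.

Lemma client_flow j x y : flow (C j) (x, y) <->
  exists k k', [/\ List.In (k, k') (client_arcs j), e k = x & e k' = y].
Proof.
split=> [/= H|[k [k' [/= H <- <-]]]].
  by in_cases H; case: H => -> ->;
     do 2 eexists; (split; [|reflexivity|reflexivity]); in_sets.
by in_cases H; case: H => <- <-; in_sets.
Qed.

(** [ok] discards the pattern's arcs at the refined places; [arc_v], [arc_w], [arc_cv] and [arc_cw]
    replace them. *)
Inductive arc : node -> node -> Prop :=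
| arc_S k k' : ok (NE k) -> ok (NE k') -> List.In (k, k') server_arcs ->
    arc (NE k) (NE k')
| arc_C j k k' : ok (NE k) -> ok (NE k') -> List.In (k, k') (client_arcs j) ->
    arc (NE k) (NE k')
| arc_v : arc (NE Sv) (NN iN)
| arc_w : arc (NN fN) (NE Sw)
| arc_cv j : arc (NE (Cv j)) (NM j (iM j))
| arc_cw j : arc (NM j (fM j)) (NE (Cw j))
| arc_Nin t d p a q X : arcs_of N t d p a q ->
    List.In X (edge_pre d (NN p) a) -> arc X (NN t)
| arc_Nout t d p a q X : arcs_of N t d p a q ->
    List.In X (edge_post d (NN q) a) -> arc (NN t) X
| arc_Min j t d p a q X : arcs_of (M j) t d p a q ->
    List.In X (edge_pre d (NM j p) a) -> arc X (NM j t)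
| arc_Mout j t d p a q X : arcs_of (M j) t d p a q ->
    List.In X (edge_post d (NM j q) a) -> arc (NM j t) X.

Inductive trans : node -> seq node -> seq node -> Prop :=
| trans_u : trans (NE Su) [:: NE Si; NE A1] [:: NE Sp]
| trans_v : trans (NE Sv) [:: NE Sp] [:: NN iN; NE A2]
| trans_w : trans (NE Sw) [:: NN fN; NE A3] [:: NE Sr]
| trans_t : trans (NE St) [:: NE Sr] [:: NE Si]
| trans_N t d p a q : arcs_of N t d p a q ->
    trans (NN t) (edge_pre d (NN p) a) (edge_post d (NN q) a)
| trans_cu j : trans (NE (Cu j)) [:: NE (Ci j)] [:: NE (Cp j); NE A1]
| trans_cv j : trans (NE (Cv j)) [:: NE (Cp j); NE A2] [:: NM j (iM j)]
| trans_cw j : trans (NE (Cw j)) [:: NM j (fM j)] [:: NE (Cr j); NE A3]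
| trans_M j t d p a q : arcs_of (M j) t d p a q ->
    trans (NM j t) (edge_pre d (NM j p) a) (edge_post d (NM j q) a).

Let pl_iN : pl N iN. Proof. exact: ini_pl iN_ini. Qed.
Let pl_fN : pl N fN. Proof. exact: fin_pl fN_fin. Qed.
Let pl_iM j : pl (M j) (iM j). Proof. exact: ini_pl (iM_ini j). Qed.
Let pl_fM j : pl (M j) (fM j). Proof. exact: fin_pl (fM_fin j). Qed.

Lemma arcs_ok t d p a q : arcs_of N t d p a q ->
  [/\ ok (NN t), ok (NN p), ok (NI a) & ok (NN q)].
Proof.
move=> [tt pp qq ai _ _]; split; [by right|by left| |by left].
by case: d ai; [right|left].
Qed.

Lemma mirror_arcs_ok j t d p a q : arcs_of (M j) t d p a q ->
  [/\ ok (NM j t), ok (NM j p), ok (NI a) & ok (NM j q)].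
Proof.
move=> [tt pp qq ai _ _]; split; [by right|by left| |by left].
by apply: (mirror_iface (M_mirror j) (@M_glue j)); case: d ai; [right|left].
Qed.

Lemma trans_ok T pre post : trans T pre post ->
  [/\ ok T, forall X, List.In X pre -> ok X & forall X, List.In X post -> ok X].
Proof.
have okN := (or_introl pl_iN : ok (NN iN), or_introl pl_fN : ok (NN fN)).
have okM j := (or_introl (pl_iM j) : ok (NM j (iM j)),
  or_introl (pl_fM j) : ok (NM j (fM j))).
case=> {T pre post}.
1-4, 6-8: try move=> j; split=> // X XI; in_cases XI; subst X;
  by [|apply: okN.1|apply: okN.2|apply: (okM j).1
  |apply: (okM j).2].
- move=> t d p a q /arcs_ok[? ? ? ?]; split => // X;
  by case: (d) => /= XI; in_cases XI; rewrite -XI.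
- move=> j t d p a q /mirror_arcs_ok[? ? ? ?]; split => // X;
  by case: (d) => /= XI; in_cases XI; rewrite -XI.
Qed.

Lemma arc_ok X Y : arc X Y -> ok X /\ ok Y.
Proof.
case=> {X Y} //.
- by split => //; left; exact: pl_iN.
- by split => //; left; exact: pl_fN.
- by split => //; left; exact: pl_iM.
- by split => //; left; exact: pl_fM.
- by move=> t d p a q X /trans_N/trans_ok[? h _] /h.
- by move=> t d p a q X /trans_N/trans_ok[? _ h] /h.
- by move=> j t d p a q X /trans_M/trans_ok[? h _] /h.
- by move=> j t d p a q X /trans_M/trans_ok[? _ h] /h.
Qed.

Lemma place_not_tr (K : opn U Lb) t d p a q : is_opn K ->
  arcs_of K t d p a q -> ~ pl K t.
Proof. by move=> Ko A tK; apply: (place_tr Ko (or_introl tK) (arcs_tr A)). Qed.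

Ltac arc_intro := solve [econstructor | econstructor; first [exact I | in_sets]
  | eapply arc_C; first [exact I | in_sets]].

(* Disposes of the arcs that do not touch the transition at hand, and of those
   listed in the pattern. *)
Ltac arc_elim := try match goal with
  | H : List.In (_, _) _ |- _ => simpl in H; in_cases H; try discriminate H;
     injection H; intros; subst; try contradiction; solve [in_sets]
  | H : List.In ?Y (_ ?d _ _) |- List.In ?X (_ :: _) =>
     destruct d; simpl in H; in_cases H; discriminate H
  | |- List.In _ (_ :: _) => in_sets
  | A : arcs_of N ?t _ _ _ _, B : arcs_of N ?t _ _ _ _ |- _ =>
    by have [? ? ? ?] := arcs_inj N_port A B; subst
  | A : arcs_of (M ?j) ?t _ _ _ _, B : arcs_of (M ?j) ?t _ _ _ _ |- _ =>
    by have [? ? ? ?] := arcs_inj (@M_port j) A B; subst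
  | A : arcs_of N ?t _ _ _ _, H : List.In (NN ?t) (_ ?d _ _) |- _ =>
    destruct d; simpl in H; in_cases H; (try discriminate H); injection H;
    intros; subst; exfalso; apply: (place_not_tr N_opn A);
    first [eapply arcs_src; eassumption | eapply arcs_dst; eassumption]
  | A : arcs_of (M ?j) ?t _ _ _ _, H : List.In (NM _ ?t) (_ ?d _ _) |- _ =>
    destruct d; simpl in H; in_cases H; (try discriminate H); injection H;
    intros; subst; exfalso; apply: (place_not_tr (@M_opn j) A);
    first [eapply arcs_src; eassumption | eapply arcs_dst; eassumption]
  | A : arcs_of N _ _ _ _ _ |- _ =>
    by case: (place_not_tr N_opn A); first [exact pl_iN | exact pl_fN]
  | A : arcs_of (M ?j) _ _ _ _ _ |- _ =>
    by case: (place_not_tr (@M_opn j) A); first [exact: pl_iM | exact: pl_fM]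
  end.

Lemma trans_pre T pre post X : trans T pre post -> arc X T <-> List.In X pre.
Proof.
move=> tT; split => [XT|]; last first.
  case: tT => {T pre post} [| | | |t d p a q A|j|j|j|j t d p a q A] XI;
    first [exact: arc_Nin A XI | exact: arc_Min A XI | simpl in XI; in_cases XI;
    subst X; arc_intro].
by destruct tT; inversion XT; subst; clear XT; arc_elim.
Qed.

Lemma trans_post T pre post X : trans T pre post -> arc T X <-> List.In X post.
Proof.
move=> tT; split => [XT|]; last first.
  case: tT => {T pre post} [| | | |t d p a q A|j|j|j|j t d p a q A] XI;
    first [exact: arc_Nout A XI | exact: arc_Mout A XI | simpl in XI; in_cases XI;
    subst X; arc_intro].
by destruct tT; inversion XT; subst; clear XT; arc_elim.
Qed.

Notation L := (compose (refined_family e lu lv lw lt N M)).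

Lemma flow_arc_N x y : flow N (x, y) ->
  exists X Y, [/\ arc X Y, dec X = x & dec Y = y].
Proof.
move=> xy; case: (flow_nodes N_opn xy) => [[_ ty]|[tx _]].
  have [d [p [a [q A]]]] := tr_arcs N_port ty.
  case: ((arcs_in A x).1 xy) => [->|[dE ->]].
    by exists (NN p), (NN y); split => //; apply: arc_Nin A _; left.
  exists (NI a), (NN y); split => //; apply: arc_Nin A _.
  by case: d dE => // _; in_sets.
have [d [p [a [q A]]]] := tr_arcs N_port tx.
case: ((arcs_out A y).1 xy) => [->|[dE ->]].
  by exists (NN x), (NN q); split => //; apply: arc_Nout A _; left.
exists (NN x), (NI a); split => //; apply: arc_Nout A _.
by case: d dE => // _; in_sets.
Qed.

Lemma flow_arc_M j x y : flow (M j) (x, y) ->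
  exists X Y, [/\ arc X Y, dec X = x & dec Y = y].
Proof.
move=> xy; case: (flow_nodes (@M_opn j) xy) => [[_ ty]|[tx _]].
  have [d [p [a [q A]]]] := tr_arcs (@M_port j) ty.
  case: ((arcs_in A x).1 xy) => [->|[dE ->]].
    by exists (NM j p), (NM j y); split => //; apply: arc_Min A _; left.
  exists (NI a), (NM j y); split => //; apply: arc_Min A _.
  by case: d dE => // _; in_sets.
have [d [p [a [q A]]]] := tr_arcs (@M_port j) tx.
case: ((arcs_out A y).1 xy) => [->|[dE ->]].
  by exists (NM j x), (NM j q); split => //; apply: arc_Mout A _; left.
exists (NM j x), (NI a); split => //; apply: arc_Mout A _.
by case: d dE => // _; in_sets.
Qed.

Lemma flow_arc x y : flow L (x, y) ->
  exists X Y, [/\ arc X Y, dec X = x & dec Y = y].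
Proof.
case=> K [[j _ <-]|->] /= [[[[/= xy nxy]|xy]|[/= xy yi]]|[/= xf xy]].
- case/client_flow: xy nxy => k [k' [kk <- <-]] nxy.
  (* The arcs at the refined place, which are not [ok], contradict [nxy]. *)
  exists (NE k), (NE k'); split => //; apply: arc_C (kk); simpl in kk; in_cases kk;
    case: kk nxy => <- <- nxy //; case: nxy;
    first [left; split; in_sets | right; split; in_sets].
- exact: flow_arc_M xy.
- case/client_flow: xy => k [k' [kk <- /e_inj kE]]; subst k'.
  rewrite iM_ini in yi; rewrite yi; exists (NE k), (NM j (iM j)); split => //.
  by simpl in kk; in_cases kk; case: kk => // <-; exact: arc_cv.
- case/client_flow: xy => k [k' [kk /e_inj kE <-]]; subst k.
  rewrite fM_fin in xf; rewrite xf; exists (NM j (fM j)), (NE k'); split => //.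
  by simpl in kk; in_cases kk; case: kk => // <-; exact: arc_cw.
- case/server_flow: xy nxy => k [k' [kk <- <-]] nxy.
  exists (NE k), (NE k'); split => //; apply: arc_S (kk); simpl in kk; in_cases kk;
    case: kk nxy => <- <- nxy //; case: nxy;
    first [left; split; in_sets | right; split; in_sets].
- exact: flow_arc_N xy.
- case/server_flow: xy => k [k' [kk <- /e_inj kE]]; subst k'.
  rewrite iN_ini in yi; rewrite yi; exists (NE k), (NN iN); split => //.
  by simpl in kk; in_cases kk; case: kk => // <-; exact: arc_v.
- case/server_flow: xy => k [k' [kk /e_inj kE <-]]; subst k.
  rewrite fN_fin in xf; rewrite xf; exists (NN fN), (NE k'); split => //.
  by simpl in kk; in_cases kk; case: kk => // <-; exact: arc_w.
Qed.

Lemma arcs_in_flow (K : opn U Lb) t d p a q (g : U -> node) X :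
  arcs_of K t d p a q -> dec (g p) = p ->
  List.In X (edge_pre d (g p) a) -> flow K (dec X, t).
Proof.
move=> A gp XI; apply/(arcs_in A).
by case: (d) XI => /= XI; in_cases XI; rewrite -XI /= ?gp; first [by left | by right].
Qed.

Lemma arcs_out_flow (K : opn U Lb) t d p a q (g : U -> node) X :
  arcs_of K t d p a q -> dec (g q) = q ->
  List.In X (edge_post d (g q) a) -> flow K (t, dec X).
Proof.
move=> A gp XI; apply/(arcs_out A).
by case: (d) XI => /= XI; in_cases XI; rewrite -XI /= ?gp; first [by left | by right].
Qed.

Lemma arc_flow X Y : arc X Y -> flow L (dec X, dec Y).
Proof.
have inS x y : flow RS (x, y) -> flow L (x, y) by exists RS => //; right.
have inC j x y : flow (RC j) (x, y) -> flow L (x, y).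
  by exists (RC j) => //; left; exists j.
case=> {X Y} [k k' okk okk' kk|j k k' okk okk' kk||||||||] /=.
- apply: inS; left; left; left; split; first by apply/server_flow; exists k, k'.
  by case=> -[/= h1 h2]; [move: h2 => /e_inj h|move: h1 => /e_inj h]; subst.
- apply: (inC j); left; left; left; split; first by apply/client_flow; exists k, k'.
  by case=> -[/= h1 h2]; [move: h2 => /e_inj h|move: h1 => /e_inj h]; subst.
- by apply: inS; left; right; rewrite iN_ini; split => //=; in_sets.
- by apply: inS; right; rewrite fN_fin; split => //=; in_sets.
- by move=> j; apply: (inC j); left; right; rewrite iM_ini; split => //=; in_sets.
- by move=> j; apply: (inC j); right; rewrite fM_fin; split => //=; in_sets.
- by move=> t d p a q X A XI; apply: inS; left; left; right;
  exact: (arcs_in_flow (g := NN) A erefl XI).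
- by move=> t d p a q X A XI; apply: inS; left; left; right;
  exact: (arcs_out_flow (g := NN) A erefl XI).
- move=> j t d p a q X A XI; apply: (inC j); left; left; right.
  exact: (arcs_in_flow (g := NM j) A erefl XI).
- move=> j t d p a q X A XI; apply: (inC j); left; left; right.
  exact: (arcs_out_flow (g := NM j) A erefl XI).
Qed.

Lemma tr_trans t : tr L t <-> exists T pre post, trans T pre post /\ dec T = t.
Proof.
split=> [[K [[j _ <-]|->] /= [|]]|].
- move=> H; in_cases H; rewrite H;
    [exists (NE (Cu j))|exists (NE (Cv j))|exists (NE (Cw j))];
    by do 2 eexists; (split; [constructor|]).
- move=> /(tr_arcs (@M_port j))[d [p [a [q A]]]].
  by do 3 eexists; split; [apply: trans_M A|].
- move=> H; in_cases H; rewrite H;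
    [exists (NE Su)|exists (NE Sv)|exists (NE Sw)|exists (NE St)];
    by do 2 eexists; (split; [constructor|]).
- move=> /(tr_arcs N_port)[d [p [a [q A]]]].
  by do 3 eexists; split; [apply: trans_N A|].
have inS x : tr RS x -> tr L x by exists RS => //; right.
have inC j x : tr (RC j) x -> tr L x by exists (RC j) => //; left; exists j.
case=> T [pre [post [tT <-]]]; 
  case: tT => {T pre post t} [| | | |t d p a q A|j|j|j|j t d p a q A] /=;
  first [by apply: inS; in_sets | by apply: (inC j); in_sets | idtac].
  by apply: inS; right; exact: arcs_tr A.
by apply: (inC j); right; exact: arcs_tr A.
Qed.

(** * Firing in terms of lists of nodes *)

Definition tokens (l : seq node) : marking U :=
  fun x => count_mem x [seq dec X | X <- l].

Lemma in_map_dec l x : reflect (exists2 X, List.In X l & dec X = x)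
  (x \in [seq dec X | X <- l]).
Proof.
elim: l => [|Y l IH] /=; first by constructor; case.
rewrite inE; case: eqVneq => [->|xY] /=.
  by constructor; exists Y => //; left.
apply: (iffP IH) => -[X Xl Xx]; exists X => //; first by right.
by case: Xl => // YX; rewrite -Xx YX eqxx in xY.
Qed.

(** A bag of a set counts each node once, so the list must have no repetition, even after [dec]. *)
Lemma bag_tokens (A : set U) l : uniq [seq dec X | X <- l] ->
  (forall x, A x <-> exists2 X, List.In X l & dec X = x) -> bag A = tokens l.
Proof.
move=> ul Al; apply: funext => x; rewrite /tokens count_uniq_mem //.
rewrite /bag; congr (nat_of_bool _).
by apply/idP/idP => [|/in_map_dec]; rewrite inE => /Al // /in_map_dec.
Qed.

Lemma dec_neq X Y : ok X -> ok Y -> X <> Y -> dec X != dec Y.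
Proof. by move=> oX oY XY; apply/eqP => /(dec_inj oX oY). Qed.

Lemma trans_uniq T pre post : trans T pre post ->
  uniq [seq dec X | X <- pre] /\ uniq [seq dec X | X <- post].
Proof.
move=> tT; have [_] := trans_ok tT.
have uniq2 X Y : ok X -> ok Y -> X <> Y -> uniq [:: dec X; dec Y].
  by move=> oX oY XY; rewrite /= inE dec_neq.
case: tT => {T pre post} [| | | |t d p a q A|j|j|j|j t d p a q A] okpre okpost;
  try (destruct d); (split; [move: okpre|move: okpost]) => okl; first [by [] |
  by apply: uniq2 => //; apply: okl; in_sets].
Qed.

Lemma trans_bag T pre post : trans T pre post ->
  bag (preset (flow L) (dec T)) = tokens pre /\
  bag (postset (flow L) (dec T)) = tokens post.
Proof.
move=> tT; have [okT _ _] := trans_ok tT; have [upre upost] := trans_uniq tT.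
split; apply: bag_tokens => // x; split.
- move=> /flow_arc[X [Y [XY <- TY]]]; exists X => //.
  by apply/(trans_pre _ tT); rewrite -(dec_inj (arc_ok XY).2 okT TY).
- by case=> X /(trans_pre _ tT) /arc_flow XT <-.
- move=> /flow_arc[X [Y [XY TX <-]]]; exists Y => //.
  by apply/(trans_post _ tT); rewrite -(dec_inj (arc_ok XY).1 okT TX).
- by case=> X /(trans_post _ tT) /arc_flow XT <-.
Qed.

Lemma step_trans m m' : step (net_of L) m m' <->
  exists T pre post, [/\ trans T pre post, forall x, tokens pre x <= m x &
    m' = fun x => m x - tokens pre x + tokens post x].
Proof.
split=> [[t [/= /tr_trans[T [pre [post [tT <-]]]]]]|[T [pre [post [tT em ->]]]]].
  have [preE postE] := trans_bag tT; rewrite preE => em ->.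
  by exists T, pre, post; split => //; rewrite /fire /= preE postE.
have [preE postE] := trans_bag tT.
exists (dec T); last by rewrite /fire /= preE postE.
split; first by apply/tr_trans; exists T, pre, post.
by move=> x; rewrite /= preE.
Qed.

(** * Configurations as markings *)

Notation config := (config U n).

Definition server_place (s : server U) : node :=
  match s with SI => NE Si | SP => NE Sp | SN x => NN x | SR => NE Sr end.

Definition client_place j (v : client U) : node :=
  match v with
  | CI => NE (Ci j) | CP => NE (Cp j) | CM y => NM j y | CR => NE (Cr j)
  end.

Definition conc (g : config) : marking U := fun x =>
  (dec (server_place (sv g)) == x) + n1 g * (e A1 == x) + n2 g * (e A2 == x)
  + n3 g * (e A3 == x) + count_mem x (ch g)
  + \sum_j (dec (client_place j (cl g j)) == x).

Notation gstep := (gstep N M iN fN iM fM).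

Lemma gstep_trans g pre post g' : gstep g pre post g' ->
  exists T, trans T pre post.
Proof.
case=> {g pre post g'}.
1-4: by eexists; constructor.
- by move=> c k1 k2 k3 h d p a q [t A] _; exists (NN t); apply: trans_N A.
1-3: by eexists; constructor.
- by move=> s c k1 k2 k3 h j d p a q _ [t A] _; exists (NM j t); apply: trans_M A.
Qed.

Lemma gstep_conc g pre post g' : gstep g pre post g' -> forall x,
  tokens pre x <= conc g x /\
  conc g' x = conc g x - tokens pre x + tokens post x.
Proof.
(* At most one client changes per step: [sum_upd] isolates its summand, and [Fle] keeps the
   truncated subtraction exact. *)
move=> st x; pose F j v : nat := dec (client_place j v) == x.
have Fle c j : F j (c j) <= \sum_k F k (c k) by rewrite (bigD1 j) //= leq_addr.
have h_le a h : a \in h -> (a == x) <= count_mem x h.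
  by case: eqP => // -> ; rewrite -has_pred1 has_count.
have ch_rem a h : a \in h ->
    count_mem x (rem a h) + (a == x) = count_mem x h.
  by move=> ah; have := h_le _ _ ah; rewrite count_rem ah /=; lia.
rewrite /conc /tokens; case: st => {g pre post g'} /=; try by move=> *; lia.
- move=> c k1 k2 k3 h [] p a q _ /= ah; first lia.
  by have := ch_rem _ _ ah; lia.
- move=> s c k1 k2 k3 h j cj; have := Fle c j; have := sum_upd F c j CP.
  by rewrite cj /F /=; lia.
- move=> s c k1 k2 k3 h j cj; have := Fle c j; have := sum_upd F c j (CM (iM j)).
  by rewrite cj /F /=; lia.
- move=> s c k1 k2 k3 h j cj; have := Fle c j; have := sum_upd F c j CR.
  by rewrite cj /F /=; lia.
- move=> s c k1 k2 k3 h j d p a q cj _ ah.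
  have := Fle c j; have := sum_upd F c j (CM q); rewrite cj /F /=.
  case: d ah => /= ah; first lia.
  by have := ch_rem _ _ ah; lia.
Qed.

Definition ok_config (g : config) : Prop :=
  [/\ ok (server_place (sv g)), forall j, ok (client_place j (cl g j))
    & forall a, a \in ch g -> iface N a].

(** Injectivity of [dec] on [ok] nodes tells which summand of [conc] put the token on [X]. *)
Lemma conc_pos g X : ok_config g -> ok X -> 0 < conc g (dec X) ->
  [\/ X = server_place (sv g), exists j, X = client_place j (cl g j)
    | exists2 a, a \in ch g & X = NI a] \/
  [\/ X = NE A1 /\ 0 < n1 g, X = NE A2 /\ 0 < n2 g | X = NE A3 /\ 0 < n3 g].
Proof.
move=> [oks okc okh] okX; rewrite /conc.
have nat_eq k Y : ok Y -> 0 < k * (dec Y == dec X) -> X = Y /\ 0 < k.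
  by move=> okY; case: eqP => [/(dec_inj okY okX)->|];
    [rewrite muln1|rewrite muln0].
rewrite !addn_gt0 -!orbA.
case/or4P => [|/(@nat_eq _ (NE A1) I)|/(@nat_eq _ (NE A2) I)|].
- by rewrite lt0b => /eqP /(dec_inj oks okX) <-; left; apply: Or31.
- by right; apply: Or31.
- by right; apply: Or32.
case/or3P => [/(@nat_eq _ (NE A3) I)||].
- by right; apply: Or33.
- rewrite -has_count has_pred1 => Xh; left; apply: Or33; exists (dec X) => //.
  by apply: dec_inj => //; exact: okh.
- rewrite lt0n sum_nat_eq0 negb_forall => /existsP[j]; rewrite eqb0 negbK => /eqP E.
  by left; apply: Or32; exists j; apply: dec_inj.
Qed.

(** Each input node carries a token, and its tag names the component of [g] that accounts for it:
    these are the premises of the step. *)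
Lemma trans_gstep g T pre post : ok_config g -> trans T pre post ->
  (forall x, tokens pre x <= conc g x) -> exists g', gstep g pre post g'.
Proof.
move=> okg tT em; have [_ okpre _] := trans_ok tT.
have pos X : List.In X pre ->
    [\/ X = server_place (sv g), exists j, X = client_place j (cl g j)
      | exists2 a, a \in ch g & X = NI a] \/
    [\/ X = NE A1 /\ 0 < n1 g, X = NE A2 /\ 0 < n2 g | X = NE A3 /\ 0 < n3 g].
  move=> XI; apply: conc_pos => //; first exact: okpre.
  apply: leq_trans (em _); rewrite /tokens -has_count has_pred1.
  by apply/in_map_dec; exists X.
case: g {em okg} pos => s c k1 k2 k3 h /= pos.
have at_s X : List.In X pre ->
   match X with NE (Si | Sp | Sr) | NN _ => X = server_place s | _ => True end.
  by move=> /pos [[->|[j ->]|[a _ ->]]|[[-> _]|[-> _]|[-> _]]] //;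
     [case: (s)|case: (c j)].
have at_c X : List.In X pre ->
   match X with
   | NE (Ci j) => c j = CI | NE (Cp j) => c j = CP
   | NM j y => c j = CM y | _ => True end.
  by move=> /pos [[->|[j ->]|[a _ ->]]|[[-> _]|[-> _]|[-> _]]] //;
     [case: (s)|case cj: (c j)].
have at_h a : List.In (NI a) pre -> a \in h.
  by move=> /pos [[|[j]|[b bh [->]]]|[[]|[]|[]]] //; [case: (s)|case: (c j)].
have at_k X : List.In X pre ->
   match X return Prop with
   | NE A1 => 0 < k1 | NE A2 => 0 < k2 | NE A3 => 0 < k3 | _ => True end.
  by move=> /pos [[->|[j ->]|[a _ ->]]|[[-> ?]|[-> ?]|[-> ?]]] //;
     [case: (s)|case: (c j)].
have at_move d X a : pre = edge_pre d X a -> d || (a \in h).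
  by case: d => // preE; apply: at_h; rewrite preE; right; left.
case: tT at_s at_c at_k at_move {pos okpre at_h} => {T pre post}
  [| | | |t d p a q A|j|j|j|j t d p a q A] at_s at_c at_k at_move.
- have := at_s (NE Si) ltac:(in_sets); have /= := at_k (NE A1) ltac:(in_sets).
  case: s {at_s} => [||x|] //; case: k1 {at_k} => // k1 _ _.
  by eexists; exact: gstep_u.
- have := at_s (NE Sp) ltac:(in_sets).
  by case: s {at_s} => [||x|] // _; eexists; exact: gstep_v.
- have := at_s (NN fN) ltac:(in_sets); have /= := at_k (NE A3) ltac:(in_sets).
  case: s {at_s} => [||x|] //; case: k3 {at_k} => // k3 _ [<-].
  by eexists; exact: gstep_w.
- have := at_s (NE Sr) ltac:(in_sets).
  by case: s {at_s} => [||x|] // _; eexists; exact: gstep_t.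
- have := at_s (NN p) ltac:(in_sets); have ah := at_move _ _ _ erefl.
  case: s {at_s} => [||x|] //= [<-]; eexists; apply: gstep_N ah; by exists t.
- by have /= cj := at_c (NE (Ci j)) ltac:(in_sets); eexists; exact: gstep_cu cj.
- have /= cj := at_c (NE (Cp j)) ltac:(in_sets).
  have /= := at_k (NE A2) ltac:(in_sets).
  by case: k2 {at_k} => // k2 _; eexists; exact: gstep_cv cj.
- by have /= cj := at_c (NM j (fM j)) ltac:(in_sets); eexists; exact: gstep_cw cj.
- have /= cj := at_c (NM j p) ltac:(in_sets); have ah := at_move _ _ _ erefl.
  by eexists; apply: gstep_M cj _ ah; exists t.
Qed.

Notation coherent := (coherent N M phi iN fN).
Notation greach := (greach N M iN fN iM fM).

Lemma coherent_ok g : coherent g -> ok_config g.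
Proof.
have run_h d p s q : run N d p s q -> forall a, a \in s -> iface N a.
  by move=> r a /(run_iface r); case: (d); [right|left].
case: g => -[||x|] c k1 k2 k3 h /= I.
1,2,4: case: I => ic _ _ _ ->; split => //= j; case cj: (c j) => [||y|] //;
  by case: (ic _ _ cj).
case: I => px I; split => /=; first by left.
  case: I => [[ic _ _ _ _]|[_ _ _ [j [y [cj py oth _]]]]|[ic _ _ _ _]] l;
    case cl: (c l) => [||z|] //; try by case: (ic _ _ cl).
  have [lj|lj] := eqVneq l j; last by case: (oth _ _ lj cl).
  by move: cl; rewrite lj cj => -[<-]; left.
case: I => [[_ _ _ _ [al r hp]]
  |[_ _ _ [j [y [_ _ _ [al [be [z [r r' hp]]]]]]]]|[_ _ _ _ [be r hp]]] a;
  rewrite (perm_mem hp); [exact: run_h r a| |exact: run_h r a].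
by rewrite mem_cat => /orP[]; [apply: run_h r' a|apply: run_h r a].
Qed.

Lemma reachable_coherent m m' : reachable (net_of L) m m' ->
  forall g, coherent g -> m = conc g -> exists2 g', coherent g' & m' = conc g'.
Proof.
elim=> {m m'}
  [m m' /step_trans[T [pre [post [tT em ->]]]]|m|m1 m2 m3 _ IH1 _ IH2] g Ig mg.
- rewrite mg in em *; have [g' st] := trans_gstep (coherent_ok Ig) tT em.
  exists g'; last by apply: funext => x; rewrite (gstep_conc st x).2.
  exact: (coherent_step N_wf M_mirror M_glue iN_ini fN_fin iM_ini fM_fin Ig st).
- by exists g.
- by have [g' Ig' /(IH2 _ Ig')] := IH1 _ Ig mg.
Qed.

Lemma greach_reachable g g' :
  greach g g' -> reachable (net_of L) (conc g) (conc g').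
Proof.
elim=> {g g'} [g g' [pre [post st]]|g|g1 g2 g3 _ h1 _ h2].
- have [T tT] := gstep_trans st; apply: rt_step; apply/step_trans.
  exists T, pre, post; split => // [x|]; first by case: (gstep_conc st x).
  by apply: funext => x; case: (gstep_conc st x).
- exact: rt_refl.
- exact: rt_trans h1 h2.
Qed.

(** Used at [CI] for the initial marking and at [CR] for the final one. *)
Lemma conc_idle v :
  conc (Config SI (fun=> v) 0 0 0 [::]) =
  fun x => bag [set e Si] x + \sum_(j < n) bag [set dec (client_place j v)] x.
Proof.
have bag1 y x : bag [set y] x = (y == x).
  by congr (nat_of_bool _); apply/idP/eqP; rewrite inE => ->.
apply: funext => x; rewrite /conc /= !mul0n !addn0 bag1.
by congr (_ + _); apply: eq_bigr => j _; rewrite bag1.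
Qed.

Lemma composition_weakly_terminating :
  weakly_terminating (net_of L) (sync_m0 e) (sync_mf e).
Proof.
have m0E : sync_m0 e = conc (Config SI (fun=> CI) 0 0 0 [::]).
  by rewrite conc_idle.
have mfE : sync_mf e = conc (final_config U n).
  by rewrite conc_idle.
move=> m m0m; have [|g Ig ->] := reachable_coherent m0m _ m0E.
  by split => //; rewrite /waiting big1.
rewrite mfE; apply: greach_reachable.
exact: (settle N_wf M_mirror M_glue iN_ini fN_fin iM_ini fM_fin Ig).
Qed.

End Composition.

(** A pair, so that one use of choice yields the initial and final places of all mirrors. *)
Lemma portnet_ini_fin (U : eqType) (Lb : Type) (K : opn U Lb) :
  labeled_portnet K ->
  exists if_ : U * U, ini K = [set if_.1] /\ fin K = [set if_.2].
Proof. by case=> _ _ [i [f [_ iE fE]]] _ _; exists (i, f). Qed.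

Theorem theorem3 (U : eqType) (Lb : Type) (n : nat)
  (N : opn U Lb) (M : 'I_n -> opn U Lb) (phi : 'I_n -> U -> U)
  (e : sync_node n -> U) (lu lv lw lt : Lb)
  (N_wf : well_formed N)
  (N_wt : weakly_terminating (skeleton N) (bag (ini N)) (bag (fin N)))
  (M_mirror : forall j, partial_mirror N (M j) (phi j))
  (M_disj : forall j k, j <> k -> disjoint_skeletons (M j) (M k))
  (* the pattern: a copy in U of its node type *)
  (e_inj : injective e)
  (S_skel : disjoint_skeletons (sync_server e lu lv lw lt) N /\
     forall k, disjoint_skeletons (sync_server e lu lv lw lt) (M k))
  (C_skel : forall j, disjoint_skeletons (sync_client e lu lv lw j) N /\
     forall k, disjoint_skeletons (sync_client e lu lv lw j) (M k))
  (* the two refinements refine by a disjoint net *)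
  (S_disj : disjoint_nodes (sync_server e lu lv lw lt) N)
  (C_disj : forall j, disjoint_nodes (sync_client e lu lv lw j) (M j))
  (* interface places of mirrors are identified with those of N, and the
     composed nets share nothing but interface places *)
  (M_glue : forall j x, iface (M j) x -> phi j x = x)
  (L_share : forall X Y,
     refined_family e lu lv lw lt N M X -> refined_family e lu lv lw lt N M Y ->
     X <> Y -> share_only_interface X Y) :
  let L := compose (refined_family e lu lv lw lt N M) in
  weakly_terminating (net_of L) (sync_m0 e) (sync_mf e).
Proof.
move=> L; have [[N_port _ _ _] [_ S_M]] := (N_wf, S_skel).
have [[iN fN] /= [iN_ini fN_fin]] := portnet_ini_fin N_port.
have [if_ if_P] := choice (fun j => portnet_ini_fin (mirror_port (M_mirror j))).
exact: (composition_weakly_terminating N_wf M_mirror M_glue M_disj e_inj S_M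
  C_skel S_disj C_disj L_share iN_ini fN_fin
  (fun j => (if_P j).1) (fun j => (if_P j).2)).
Qed.
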